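(* Let $N,M$ be integers with $0<M<N/2$. Then the geometric realization $B\mathbf{Str}(N,M)$ of the poset $\mathbf{Str}(N,M)$ is homotopy equivalent to the circle $S^1$.
   Context: A circular symbol string of length $N$ is $s=s_1\cdots s_N$ with each $s_i\in\{0,1,X\}$, indices read cyclically modulo $N$; $0,1$ are called bits. A block of $s$ is a maximal cyclic run of consecutive equal symbols. $s$ is a circular cellular string of rank $M$ if it has exactly $M$ blocks of symbol $0$, exactly $M$ blocks of symbol $1$, and every block of symbol $X$ is cyclically preceded and followed by blocks of different bits (one of symbol $0$ and one of symbol $1$). Its dimension is its number of symbols $X$. $\mathbf{Str}(N,M)$ is the set of such strings, partially ordered by $s'<s$ iff $s$ is obtained from $s'$ by replacing some (at least one) of the bits of $s'$ by $X$. The geometric realization $B$ of a poset is the geometric realization of its order complex. *)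

(* Defs.v *)
From HB Require Import structures.
From mathcomp Require Import all_boot all_order all_algebra.
From mathcomp Require Import all_classical all_reals all_analysis.
Set Implicit Arguments. Unset Strict Implicit. Unset Printing Implicit Defensive.
Import Order.TTheory GRing.Theory Num.Theory.
Import numFieldNormedType.Exports.
Local Open Scope classical_set_scope.
Local Open Scope ring_scope.

Definition homotopic_on {R : realType} {U V : topologicalType}
  (A : set U) (C : set V) (f g : U -> V) : Prop :=
  exists H : (R * U)%type -> V,
    [/\ {within [set p | 0 <= p.1 <= 1 /\ A p.2], continuous H},
        (forall x, A x -> H (0, x) = f x /\ H (1, x) = g x) &
        (forall t x, 0 <= t <= 1 -> A x -> C (H (t, x)))].

Definition homotopy_equivalent {R : realType} {U V : topologicalType}
  (A : set U) (B : set V) : Prop :=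
  exists (f : U -> V) (g : V -> U),
    [/\ {within A, continuous f}, (forall x, A x -> B (f x)),
        {within B, continuous g}, (forall y, B y -> A (g y)) &
        (@homotopic_on R U U A A (g \o f) idfun /\
         @homotopic_on R V V B B (f \o g) idfun)].

Definition circle (R : realType) : set (R * R)%type :=
  [set p | p.1 ^+ 2 + p.2 ^+ 2 = 1].

(* For a finite poset with elements [S] (a subset of a finite type [T]) and
   strict order [lt], the realization B of its order complex (simplices =
   nonempty chains) is the set of points x of R^T (product topology) that
   are barycentric coordinates supported on a chain of S. *)
Definition realization (R : realType) (T : finType) (S : pred T) (lt : rel T)
  : set {ptws T -> R} :=
  [set x | [/\ (forall t, 0 <= x t),
              (forall t, x t != 0 -> S t),
              \sum_(t : T) x t = 1 &
              (forall t u, x t != 0 -> x u != 0 ->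
                 [\/ t = u, lt t u | lt u t])]].

Definition symb := option bool.
Definition sX : symb := None.
Definition s0 : symb := Some false.
Definition s1 : symb := Some true.

Definition cstring (N : nat) := {ffun 'I_N -> symb}.

Definition cyc_add (N : nat) (i : 'I_N) (k : nat) : 'I_N := iter k (@ordS N) i.

Definition cyc_interval (N : nat) (i : 'I_N) (l : nat) : {set 'I_N} :=
  [set cyc_add i k | k : 'I_l].

Definition is_cyc_interval (N : nat) (B : {set 'I_N}) : bool :=
  [exists i : 'I_N, exists l : 'I_N.+1, (0 < (l : nat))%N && (B == cyc_interval i l)].

Definition const_run (N : nat) (s : cstring N) (a : symb) (B : {set 'I_N}) : bool :=
  [&& is_cyc_interval B, (0 < #|B|)%N & [forall j in B, s j == a]].

Definition is_block (N : nat) (s : cstring N) (a : symb) (B : {set 'I_N}) : bool :=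
  const_run s a B &&
  [forall C : {set 'I_N}, (const_run s a C && (B \subset C)) ==> (C == B)].

Definition nblocks (N : nat) (s : cstring N) (a : symb) : nat :=
  #|[set B : {set 'I_N} | is_block s a B]|.

Definition X_blocks_ok (N : nat) (s : cstring N) : bool :=
  [forall B : {set 'I_N}, is_block s sX B ==>
     [exists i : 'I_N, exists l : 'I_N,
        [&& (0 < (l : nat))%N, B == cyc_interval i l &
           ((s (ord_pred i) == s0) && (s (cyc_add i l) == s1)) ||
           ((s (ord_pred i) == s1) && (s (cyc_add i l) == s0))]]].

Definition is_cellular (N M : nat) (s : cstring N) : bool :=
  [&& nblocks s s0 == M, nblocks s s1 == M & X_blocks_ok s].

Definition str_lt (N : nat) : rel (cstring N) := fun s' s =>
  (s' != s) &&
  [forall i, (s' i == s i) || ((s' i != sX) && (s i == sX))].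

Definition BStr (R : realType) (N M : nat) : set {ptws cstring N -> R} :=
  @realization R (cstring N) (@is_cellular N M) (@str_lt N).

(* Main.v *)
Require Import Defs.
From mathcomp Require Import all_boot all_order all_algebra.
From mathcomp Require Import all_classical all_reals all_analysis.
From mathcomp Require Import zify ring lra.
Import numFieldNormedType.Exports.
Set Implicit Arguments. Unset Strict Implicit. Unset Printing Implicit Defensive.
Import Order.TTheory GRing.Theory Num.Theory.

(* A point x of BStr is recorded by the cyclic sequence of reals
   z_k = (mass of the strings with s_k = 1) - (mass of the strings with s_k = 0),
   and x is recovered from z by cutting z at a uniformly random level in ]0, 1].
   The sequences obtained are exactly the waves: they take the values 1 and -1
   alternately 2M times around the circle and are monotone in between.
   Write z_k as the value of the triangle wave of period 2 at a phase g_k; then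
   (g_k) is nondecreasing, gains 2M per turn, and takes every integer value, and
   the map to the circle is exp(i pi g_0).  Phases form a convex set, so (g_k)
   moves linearly to the uniform phase g_0 + 2Mk/N.  This may miss integers,
   but only by a margin kappa < 1/2, thanks to 2M < N; replacing the triangle
   wave by cos clipped after multiplication by a large factor, constant within
   kappa of the integers, makes every intermediate sequence a wave again. *)

(** * Blocks of a circular string *)

(** Block counts are hard to follow along a deformation, whereas the wave conditions for given
    extremal positions are easy: they are preserved by averaging and by every nondecreasing map of
    [-1, 1] that fixes the end points. Cutting at a level is such a map, so all strings cut from a
    wave are waves with the same extremal positions, and the cellular strings of rank M are just the
    waves with values in {-1, 0, 1}. The obstacle is continuity: neither the extremal positions nor
    a branch of the phase can be chosen continuously in the point. The maps are therefore written
    with continuous quantities only: half of the total variation is the phase relative to position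
    0, and two averages over the strings determine the phase at position 0 modulo 2. Extremal
    positions are chosen point by point, merely to check that a formula stays in the realization.
    The composite on the circle is not the identity, because stretching and cutting distort the
    phase, but it never turns a point by more than a right angle. *)

Lemma inZpDp n k : inZp (k + n.+1) = inZp k :> 'I_n.+1.
Proof. by apply: val_inj; rewrite /= modnDr. Qed.

Lemma inZpMDp n m k : inZp (k + m * n.+1) = inZp k :> 'I_n.+1.
Proof. by apply: val_inj; rewrite /= addnC modnMDl. Qed.

Lemma inZp_modDl n k m : inZp ((inZp k : 'I_n.+1) + m) = inZp (k + m) :> 'I_n.+1.
Proof. by apply: val_inj; rewrite /= modnDml. Qed.

Lemma ordS_inZp n k : ordS (inZp k) = inZp k.+1 :> 'I_n.+1.
Proof. by apply: val_inj; rewrite /= -addn1 modnDml addn1. Qed.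

Lemma cyc_addE n (i : 'I_n.+1) k : cyc_add i k = inZp (i + k).
Proof.
elim: k => [|k IHk]; first by rewrite addn0 valZpK.
by rewrite /cyc_add iterS -/(cyc_add i k) IHk ordS_inZp addnS.
Qed.

Lemma inZp_predD n (i : 'I_n.+1) m : ordS (inZp (ord_pred i + m)) = inZp (i + m) :> 'I_n.+1.
Proof.
rewrite ordS_inZp -addSn -inZp_modDl -ordS_inZp valZpK.
by rewrite ord_predK.
Qed.

Lemma cyc_intervalP n (i j : 'I_n.+1) l :
  reflect (exists2 m, m < l & j = inZp (i + m)) (j \in cyc_interval i l).
Proof.
apply: (iffP imsetP) => [[m _ ->]|[m ltml ->]].
  by exists m => //; rewrite cyc_addE.
by exists (Ordinal ltml); rewrite ?inE ?cyc_addE.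
Qed.

Lemma inZp_surj_from n (i j : 'I_n.+1) : exists2 m, m < n.+1 & j = inZp (i + m).
Proof.
exists ((j + (n.+1 - i)) %% n.+1); first exact: ltn_pmod.
apply: val_inj; rewrite /= modnDmr addnCA subnKC 1?ltnW //.
by rewrite modnDr modn_small.
Qed.

Definition runlen n (s : cstring n.+1) (a : symb) (i : 'I_n.+1) : nat :=
  find (fun m => s (inZp (i + m)) != a) (iota 0 n.+1).

Section Runs.
Variables (n : nat) (s : cstring n.+1) (a : symb).
Hypothesis nconst : exists j, s j != a.

Lemma runlen_lt (i : 'I_n.+1) : runlen s a i < n.+1.
Proof.
case: nconst => j sj; have [m ltm jE] := inZp_surj_from i j.
have -> : n.+1 = size (iota 0 n.+1) by rewrite size_iota.
rewrite -has_find; apply/hasP; exists m; first by rewrite mem_iota.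
by rewrite -jE.
Qed.

Lemma runlenP (i : 'I_n.+1) : s (inZp (i + runlen s a i)) != a.
Proof.
have lt := runlen_lt i.
have H : has (fun m => s (inZp (i + m)) != a) (iota 0 n.+1).
  by rewrite has_find size_iota.
by have := nth_find 0 H; rewrite -/(runlen s a i) nth_iota.
Qed.

Lemma runlen_min (i : 'I_n.+1) m : m < runlen s a i -> s (inZp (i + m)) = a.
Proof.
move=> ltm; have := before_find 0 ltm.
by rewrite nth_iota ?add0n ?(ltn_trans ltm (runlen_lt i)) // => /negbFE/eqP.
Qed.

Lemma runlen_gt0 (i : 'I_n.+1) : s i = a -> 0 < runlen s a i.
Proof.
move=> si; rewrite lt0n; apply/eqP => r0.
by have := runlenP i; rewrite r0 addn0 valZpK si eqxx.
Qed.

Lemma runlen_ge (i : 'I_n.+1) l : (forall m, m < l -> s (inZp (i + m)) = a) -> l <= runlen s a i.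
Proof.
move=> H; rewrite leqNgt; apply/negP => /H e.
by have := runlenP i; rewrite e eqxx.
Qed.

Lemma runlen_eq (i : 'I_n.+1) l : (forall m, m < l -> s (inZp (i + m)) = a) ->
  s (inZp (i + l)) != a -> runlen s a i = l.
Proof.
move=> H nl; apply/eqP; rewrite eqn_leq runlen_ge // andbT leqNgt.
by apply/negP => /runlen_min e; rewrite e eqxx in nl.
Qed.

Lemma const_run_runlen (i : 'I_n.+1) : s i = a -> const_run s a (cyc_interval i (runlen s a i)).
Proof.
move=> si; apply/and3P; split.
- apply/existsP; exists i; apply/existsP.
  exists (inord (runlen s a i)); rewrite inordK ?eqxx ?andbT ?runlen_gt0 //.
  exact: ltnW (runlen_lt i).
- apply/card_gt0P; exists i; apply/cyc_intervalP; exists 0; rewrite ?runlen_gt0 //.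
  by rewrite addn0 valZpK.
- by apply/forall_inP => j /cyc_intervalP[m ltm ->]; rewrite runlen_min.
Qed.

Lemma run_start (i : 'I_n.+1) l (k : 'I_n.+1) : s k != a ->
  (forall j, j \in cyc_interval i l -> s j = a) ->
  ordS k \in cyc_interval i l -> ordS k = i.
Proof.
move=> sk H /cyc_intervalP[[|m] ltm kE]; first by rewrite kE addn0 valZpK.
suff E : k = inZp (i + m).
  move: sk; rewrite (H k) ?eqxx // E; apply/cyc_intervalP; exists m => //.
  exact: ltnW.
by apply: (can_inj (@ordSK _)); rewrite kE ordS_inZp addnS.
Qed.

Lemma is_block_runlen (k : 'I_n.+1) : s k != a -> s (ordS k) = a ->
  is_block s a (cyc_interval (ordS k) (runlen s a (ordS k))).
Proof.
move=> sk sk1; apply/andP; split; first exact: const_run_runlen.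
apply/forallP => C; apply/implyP => /andP[/and3P[/existsP[i /existsP[l]]]].
move=> /andP[l0 /eqP CE] _ /forall_inP Ca sub.
rewrite finset.eqEsubset sub andbT.
have {}Ca j : j \in cyc_interval i l -> s j = a by rewrite -CE => /Ca/eqP.
have iE : ordS k = i.
  apply: (run_start sk Ca); rewrite -CE; apply: (fintype.subsetP sub).
  by apply/cyc_intervalP; exists 0; rewrite ?addn0 ?valZpK ?runlen_gt0.
rewrite {}CE; apply/fintype.subsetP => j /cyc_intervalP[m ltm ->].
apply/cyc_intervalP; exists m; last by rewrite iE.
apply: leq_trans ltm _; apply: runlen_ge => m' ltm'.
by apply: Ca; apply/cyc_intervalP; exists m'; rewrite // iE.
Qed.

Lemma is_blockP B : is_block s a B ->
  exists k, [/\ s k != a, s (ordS k) = a & B = cyc_interval (ordS k) (runlen s a (ordS k))].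
Proof.
move=> /andP[/and3P[/existsP[i /existsP[l /andP[l0 /eqP BE]]] _ /forall_inP Ba]].
move=> /forallP Bmax.
have {}Ba m : m < l -> s (inZp (i + m)) = a.
  by move=> ltm; apply/eqP/Ba; rewrite BE; apply/cyc_intervalP; exists m.
have si : s i = a by have := Ba 0 l0; rewrite addn0 valZpK.
have ltl : l < n.+1 by apply: leq_ltn_trans (runlen_ge Ba) (runlen_lt i).
have sub : B \subset cyc_interval i (runlen s a i).
  rewrite BE; apply/fintype.subsetP => j /cyc_intervalP[m ltm ->].
  apply/cyc_intervalP; exists m => //; exact: leq_trans ltm (runlen_ge Ba).
have BR : cyc_interval i (runlen s a i) = B.
  by apply/eqP/(implyP (Bmax _)); rewrite const_run_runlen.
exists (ord_pred i); rewrite ord_predK; split => //.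
apply/negP => /eqP sp.
have H : const_run s a (cyc_interval (ord_pred i) l.+1).
  apply/and3P; split.
  - apply/existsP; exists (ord_pred i); apply/existsP.
    by exists (inord l.+1); rewrite inordK ?eqxx // ltnS.
  - apply/card_gt0P; exists (ord_pred i); apply/cyc_intervalP; exists 0 => //.
    by rewrite addn0 valZpK.
  - apply/forall_inP => j /cyc_intervalP[[|m] ltm ->].
      by rewrite addn0 valZpK sp.
    by rewrite addnS -ordS_inZp inZp_predD Ba.
have /(implyP (Bmax _))/eqP E : const_run s a (cyc_interval (ord_pred i) l.+1) &&
    (B \subset cyc_interval (ord_pred i) l.+1).
  rewrite H BE; apply/fintype.subsetP => j /cyc_intervalP[m ltm ->].
  apply/cyc_intervalP; exists m.+1 => //.
  by rewrite addnS -ordS_inZp inZp_predD.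
(* Otherwise a shift by [m.+1], where 0 < m.+1 <= l < n.+1, would fix [i]. *)
have : ord_pred i \in cyc_interval i l.
  rewrite -BE -E; apply/cyc_intervalP; exists 0 => //.
  by rewrite addn0 valZpK.
move=> /cyc_intervalP[m ltm] /(congr1 (@ordS n.+1)).
rewrite ord_predK ordS_inZp => /(congr1 val) /=.
have := ltn_ord i; case: (ltnP (i + m).+1 n.+1) => [lt|le].
  by rewrite modn_small //; lia.
by move=> lti; rewrite -(subnK le) modnDr modn_small; lia.
Qed.

Lemma nblocksE :
  nblocks s a = #|[set k | (s k != a) && (s (ordS k) == a)]%SET|.
Proof.
pose R k := cyc_interval (ordS k) (runlen s a (ordS k)).
rewrite -(@card_in_imset _ _ R).
  rewrite /nblocks; apply: eq_card => B.
  apply/idP/idP; rewrite in_setE /=.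
    move=> /is_blockP[k [sk sk1 ->]]; apply/imsetP; exists k => //.
    by rewrite !inE sk sk1 eqxx.
  move=> /imsetP[k]; rewrite !inE => /andP[sk /eqP sk1] ->.
  exact: is_block_runlen.
move=> k k'; rewrite !inE => /andP[sk /eqP sk1] /andP[sk' /eqP sk1'] E.
apply: (can_inj (@ordSK _)); apply: (run_start (l := runlen s a (ordS k')) sk).
  by move=> j /cyc_intervalP[m ltm ->]; rewrite runlen_min.
rewrite -/(R k') -E; apply/cyc_intervalP; exists 0; rewrite ?runlen_gt0 //.
by rewrite addn0 valZpK.
Qed.

End Runs.

Lemma big_nat_periodic (T : Type) (idx : T) (op : Monoid.law idx) (F : nat -> T) N k :
  (forall j, F (j + N) = F j) ->
  \big[op/idx]_(0 <= j < N + k) F j =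
    op (\big[op/idx]_(0 <= j < N) F j) (\big[op/idx]_(0 <= j < k) F j).
Proof.
move=> perF; rewrite (@big_cat_nat _ _ _ N 0) ?leq_addr //=; congr (op _ _).
rewrite -{1}[N]add0n big_addn addKn.
by apply: eq_bigr => j _; rewrite perF.
Qed.

(** Counting blocks by the places where they are entered replaces a set of subsets by a periodic sum
    over naturals, which can be shifted by periods and split at arbitrary positions. *)
Definition entry n (s : cstring n.+1) (a : symb) (k : nat) : bool :=
  (s (inZp k) != a) && (s (inZp k.+1) == a).

Lemma nblocks_entry n (s : cstring n.+1) (a : symb) :
  (exists j, s j != a) -> nblocks s a = \sum_(0 <= k < n.+1) entry s a k.
Proof.
move=> nconst; rewrite nblocksE // big_mkord -sum1_card big_mkcond /=.
apply: eq_bigr => k _; rewrite /entry inE -ordS_inZp valZpK.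
by case: ifP.
Qed.

Lemma nblocks_gt0 N (s : cstring N) (a : symb) :
  0 < nblocks s a -> exists j, s j = a.
Proof.
move=> /card_gt0P[B]; rewrite in_setE => /andP[/and3P[_ /card_gt0P[j jB]]].
by move=> /forall_inP/(_ j jB)/eqP; exists j.
Qed.

Definition flanked n (s : cstring n.+1) : Prop := forall k l,
  s (inZp k) != sX -> (forall j, 0 < j <= l -> s (inZp (k + j)) = sX) -> 0 < l ->
  s (inZp (k + l.+1)) != sX -> s (inZp k) != s (inZp (k + l.+1)).

(** The witnesses [i] and [l] of [X_blocks_ok] are forced: both flanking symbols are bits, so they
    can only be the start and the length of the maximal run. *)
Lemma X_blocks_okP n (s : cstring n.+1) : (exists j, s j != sX) ->
  X_blocks_ok s <-> flanked s.
Proof.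
move=> nconst; split=> [/forallP H k l sk sX l0 sl|H].
- have E m : inZp ((ordS (inZp k) : 'I_n.+1) + m) = inZp (k + m.+1) :> 'I_n.+1.
    by rewrite ordS_inZp inZp_modDl addSnnS.
  have rl : runlen s None (ordS (inZp k)) = l.
    apply: runlen_eq => // [m ltm|]; last by rewrite E.
    by rewrite E sX.
  have sk1 : s (ordS (inZp k)) = None by rewrite ordS_inZp -(addn1 k) sX.
  have /implyP/(_ (is_block_runlen nconst sk sk1)) :=
    H (cyc_interval (ordS (inZp k)) (runlen s None (ordS (inZp k)))).
  move=> /existsP[i /existsP[l' /and3P[l'0 /eqP BE fl]]].
  have si : s (ord_pred i) != None.
    by case/orP: fl => /andP[/eqP-> _].
  have sl' : s (cyc_add i l') != None.
    by case/orP: fl => /andP[_ /eqP->].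
  have run j : j \in cyc_interval i l' -> s j = None.
    by rewrite -BE => /cyc_intervalP[m ltm ->]; rewrite (runlen_min nconst).
  have iE : i = ordS (inZp k).
    have iP : ordS (ord_pred i) \in cyc_interval (ordS (inZp k)) (runlen s None (ordS (inZp k))).
      rewrite BE ord_predK; apply/cyc_intervalP; exists 0; rewrite // addn0 valZpK //.
    have := run_start si _ iP; rewrite ord_predK; apply=> j.
    by rewrite BE; exact: run.
  have l'E : nat_of_ord l' = l.
    rewrite -rl -iE; apply/esym/runlen_eq => //; last by rewrite -cyc_addE.
    by move=> m ltm; apply: run; apply/cyc_intervalP; exists m.
  move: fl; rewrite cyc_addE iE ordSK l'E E.
  by case/orP => /andP[/eqP-> /eqP->].
- apply/forallP => B; apply/implyP => /(is_blockP nconst)[k [sk sk1 BE]].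
  set r := runlen _ _ _ in BE.
  have E m : inZp (ordS k + m) = inZp (k + m.+1) :> 'I_n.+1.
    by rewrite -{1}[k]valZpK ordS_inZp inZp_modDl addSnnS.
  have r0 : 0 < r by apply: runlen_gt0.
  have := H k r; rewrite valZpK => /(_ sk) H1.
  have sr := runlenP nconst (ordS k); rewrite -/r E in sr.
  have {}H1 := H1 _ r0 sr.
  apply/existsP; exists (ordS k); apply/existsP.
  exists (Ordinal (runlen_lt nconst (ordS k))); rewrite /= -/r r0 BE eqxx /=.
  rewrite ordSK cyc_addE E.
  have {}H1 : s k != s (inZp (k + r.+1)).
    by apply: H1 => -[//|j] /andP[_ lej]; rewrite -E (runlen_min nconst).
  by move: sk sr H1; case: (s k) => [[]|] //; case: (s _) => [[]|].
Qed.

(** * Waves *)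

Local Open Scope ring_scope.

Definition sg (R : realType) (a : symb) : R :=
  if a is Some b then (if b then 1 else -1) else 0.

(* [p i] is the position of the i-th extremum of the N-periodic extension of a wave,
   the even ones being maxima. *)
Definition anchors (M N : nat) (p : nat -> nat) : Prop :=
  (forall i, (p i < p i.+1)%N) /\ (forall i, p (i + 2 * M)%N = (p i + N)%N).

(** The sign lets one inequality cover descents from maxima and ascents from minima. Positions
    before [p 0] are left free; where they matter, periodicity of [z] brings them past [p 0]. *)
Definition wave (R : realType) (p : nat -> nat) (z : nat -> R) : Prop :=
  (forall i, z (p i) = (-1) ^+ i) /\
  (forall i k, (p i <= k < p i.+1)%N -> 0 <= (-1) ^+ i * (z k - z k.+1)).

(** On a wave, half of this is the phase up to a constant: each segment between consecutive extrema
    contributes 2, and the phase gains 1 there. Unlike the anchors it is continuous in [z]. *)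
Definition variation (R : realType) (z : nat -> R) (k : nat) : R :=
  \sum_(0 <= j < k) `|z j.+1 - z j|.

Lemma sign_cases (R : realType) i : (-1) ^+ i = 1 :> R \/ (-1) ^+ i = -1 :> R.
Proof. by rewrite -signr_odd; case: odd; [right|left]. Qed.

Lemma anchors_locate M N p k : anchors M N p -> (p 0 <= k)%N ->
  exists i, (p i <= k < p i.+1)%N.
Proof.
move=> [pS _]; elim: k => [|k IHk].
  by move=> p0; exists 0%N; rewrite p0 (leq_ltn_trans _ (pS 0%N)).
rewrite leq_eqVlt => /predU1P[<-|]; first by exists 0%N; rewrite leqnn pS.
rewrite ltnS => /IHk[i /andP[le lt]]; case: (ltnP k.+1 (p i.+1)) => [lt'|ge].
  by exists i; rewrite lt' (leqW le).
exists i.+1; rewrite ge /=; apply: leq_ltn_trans (pS i.+1); exact: lt.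
Qed.

Lemma wave_mono (R : realType) p (z : nat -> R) i k l : wave p z ->
  (p i <= k)%N -> (k <= l)%N -> (l <= p i.+1)%N -> (-1) ^+ i * z l <= (-1) ^+ i * z k.
Proof.
move=> [_ zm] pk; elim: l => [|l IHl]; first by rewrite leqn0 => /eqP->.
rewrite leq_eqVlt => /predU1P[<-//|]; rewrite ltnS => kl lp.
apply: le_trans (IHl kl (ltnW lp)).
by have := zm i l; rewrite lp (leq_trans pk kl) mulrBr => /(_ isT); lra.
Qed.

Lemma wave_segment (R : realType) p (z : nat -> R) i k : wave p z ->
  (p i <= k <= p i.+1)%N -> -1 <= z k <= 1.
Proof.
move=> W /andP[pk kp].
have := wave_mono W (leqnn _) pk kp; have := wave_mono W pk kp (leqnn _).
rewrite !(proj1 W) exprS.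
by case: (sign_cases R i) => ->; lra.
Qed.

Lemma wave_bound (R : realType) M N p (z : nat -> R) k : anchors M N p -> wave p z ->
  (p 0 <= k)%N -> -1 <= z k <= 1.
Proof.
move=> A W /(anchors_locate A)[i /andP[le lt]].
by apply: (wave_segment (i := i) W); rewrite le ltnW.
Qed.

Lemma wave_comp (R : realType) (m : R -> R) p (z : nat -> R) :
  (forall x y, -1 <= x -> x <= y -> y <= 1 -> m x <= m y) -> m 1 = 1 -> m (-1) = -1 ->
  (forall i, p i < p i.+1)%N ->
  wave p z -> wave p (m \o z).
Proof.
move=> mm m1 mN1 pS W; split=> [i|i k /andP[le lt]] /=.
  by rewrite (proj1 W); case: (sign_cases R i) => ->.
have /andP[bk1 bk2] : -1 <= z k <= 1 by apply: (wave_segment (i := i) W); rewrite le ltnW.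
have /andP[bl1 bl2] : -1 <= z k.+1 <= 1 by apply: (wave_segment (i := i) W); rewrite leqW.
have := proj2 W i k; rewrite le lt => /(_ isT).
case: (sign_cases R i) => -> H.
  by rewrite mul1r subr_ge0; apply: mm => //; lra.
by rewrite mulN1r opprB subr_ge0; apply: mm => //; lra.
Qed.

Lemma wave_sum (R : realType) (T : finType) (x : T -> R) (w : T -> nat -> R) p :
  (forall t, 0 <= x t) -> \sum_t x t = 1 -> (forall t, x t != 0 -> wave p (w t)) ->
  wave p (fun k => \sum_t x t * w t k).
Proof.
move=> x0 x1 W; split=> [i|i k H].
  transitivity ((\sum_t x t) * (-1) ^+ i); last by rewrite x1 mul1r.
  rewrite mulr_suml; apply: eq_bigr => t _.
  by have [->|/W[-> _]//] := eqVneq (x t) 0; rewrite !mul0r.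
rewrite -sumrB mulr_sumr; apply: sumr_ge0 => t _.
have [->|/W[_ Wt]] := eqVneq (x t) 0; first by rewrite !mul0r subrr mulr0.
by rewrite -mulrBr mulrCA mulr_ge0 ?Wt.
Qed.

Lemma variationS (R : realType) (z : nat -> R) k :
  variation z k.+1 = variation z k + `|z k.+1 - z k|.
Proof. by rewrite /variation big_nat_recr. Qed.

Lemma variation_ge (R : realType) (z : nat -> R) k l : (k <= l)%N ->
  `|z l - z k| <= variation z l - variation z k.
Proof.
elim: l => [|l IHl]; first by rewrite leqn0 => /eqP->; rewrite !subrr normr0.
rewrite leq_eqVlt => /predU1P[->|]; first by rewrite !subrr normr0.
rewrite ltnS variationS => /IHl {}IHl.
have -> : z l.+1 - z k = (z l.+1 - z l) + (z l - z k) by ring.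
by apply: le_trans (ler_normD _ _) _; lra.
Qed.

Lemma variation_mono (R : realType) (z : nat -> R) k l : (k <= l)%N ->
  variation z k <= variation z l.
Proof. by move=> /(variation_ge z); have := normr_ge0 (z l - z k); lra. Qed.

Lemma variation_periodic (R : realType) (z : nat -> R) N k :
  (forall j, z (j + N)%N = z j) -> variation z (k + N) = variation z k + variation z N.
Proof.
move=> zN; rewrite addnC [RHS]addrC; apply: big_nat_periodic => j.
by rewrite -addSn !zN.
Qed.

Lemma wave_variation_in (R : realType) p (z : nat -> R) i k : wave p z ->
  (p i <= k <= p i.+1)%N -> variation z k = variation z (p i) + (1 - (-1) ^+ i * z k).
Proof.
move=> W; elim: k => [|k IHk] /andP[].
  rewrite leqn0 => /eqP pi0 _; rewrite pi0 -[in z 0%N]pi0 (proj1 W).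
  by case: (sign_cases R i) => ->; ring.
rewrite leq_eqVlt => /predU1P[<- _|].
  by rewrite (proj1 W); case: (sign_cases R i) => ->; ring.
rewrite ltnS => le lt; rewrite variationS IHk ?le ?(ltnW lt) //.
have := proj2 W i k; rewrite le lt => /(_ isT).
case: (sign_cases R i) => -> H.
  by rewrite ler0_norm; lra.
by rewrite ger0_norm; lra.
Qed.

Lemma wave_variation (R : realType) M N p (z : nat -> R) i : anchors M N p -> wave p z ->
  variation z (p i) = variation z (p 0%N) + 2 * i%:R.
Proof.
move=> [pS _] W; elim: i => [|i IHi]; first by rewrite mulr0 addr0.
rewrite (wave_variation_in (i := i) W) ?leqnn ?(ltnW (pS i)) // IHi (proj1 W).
rewrite exprS -[i.+1]addn1 natrD.
by case: (sign_cases R i) => ->; ring.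
Qed.

Lemma wave_variation_period (R : realType) M N p (z : nat -> R) :
  anchors M N p -> wave p z -> (forall j, z (j + N)%N = z j) ->
  variation z N = 4 * M%:R.
Proof.
move=> A W zN; have := wave_variation (0 + 2 * M)%N A W.
rewrite (proj2 A) variation_periodic // add0n natrM; lra.
Qed.

(* Between consecutive anchors the variation is at least 2, so a total of 4M over
   the 2M segments of a period leaves no room for a non-monotone segment. *)
Lemma wave_of_variation (R : realType) M N p (z : nat -> R) :
  (0 < M)%N -> anchors M N p -> (forall j, z (j + N)%N = z j) ->
  variation z N = 4 * M%:R -> (forall i, z (p i) = (-1) ^+ i) -> wave p z.
Proof.
move=> M0 A zN VN zp; split=> // i k /andP[le lt].
have step j : variation z (p j) + 2 <= variation z (p j.+1).
  have := variation_ge z (ltnW (proj1 A j)); rewrite !zp exprS.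
  case: (sign_cases R j) => -> H.
    by have := ler_norm (-(-1 * 1 - 1) : R); rewrite normrN; lra.
  by have := ler_norm (-1 * -1 - -1 : R); lra.
have many l : variation z (p i.+1) + 2 * l%:R <= variation z (p (i.+1 + l)%N).
  elim: l => [|l IHl]; first by rewrite addn0 mulr0 addr0.
  by rewrite addnS -natr1; have := step (i.+1 + l)%N; lra.
have seg : variation z (p i.+1) <= variation z (p i) + 2.
  have := many (2 * M).-1; rewrite addSnnS prednK ?muln_gt0 // (proj2 A).
  rewrite variation_periodic // VN.
  have -> : (2 * M).-1%:R = 2 * M%:R - 1 :> R.
    by rewrite -natrM -{2}(@prednK (2 * M)) ?muln_gt0 // -[in RHS]natr1; ring.
  by lra.
have := variation_ge z le; have := variation_ge z lt; rewrite !zp variationS exprS.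
case: (sign_cases R i) => -> H1 H2.
  have := ler_norm (- (z k - 1)); have := ler_norm (- (z k.+1 - z k)).
  have := ler_norm (z k.+1 - z k).
  have := ler_norm (- (-1 * 1 - z k.+1)); rewrite !normrN; lra.
have := ler_norm (z k - -1); have := ler_norm (- (z k.+1 - z k)).
have := ler_norm (z k.+1 - z k).
have := ler_norm (-1 * -1 - z k.+1); rewrite !normrN; lra.
Qed.

(** * Cellular strings are waves *)

Definition sgs (R : realType) n (s : cstring n.+1) (k : nat) : R := sg R (s (inZp k)).

Lemma sgsDp (R : realType) n (s : cstring n.+1) k : sgs R s (k + n.+1)%N = sgs R s k.
Proof. by rewrite /sgs inZpDp. Qed.

Lemma sg_bit (R : realType) i a : sg R a = (-1) ^+ i <-> a = Some (~~ odd i).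
Proof.
rewrite -signr_odd; case: a => [[]|]; case: odd => /=; rewrite ?expr0 ?expr1; split => //.
all: by [move=> H; exfalso; lra | case].
Qed.

Lemma sgsP (R : realType) n (s : cstring n.+1) p i : wave p (sgs R s) ->
  s (inZp (p i)) = Some (~~ odd i).
Proof. by move=> [/(_ i)/sg_bit]. Qed.

(** A monotone segment can enter only the bit at which it ends, [Some (odd i)], and having entered
    it cannot leave it. *)
Lemma wave_entry_in (R : realType) n (s : cstring n.+1) p i b k : wave p (sgs R s) ->
  (p i <= k <= p i.+1)%N ->
  (\sum_(p i <= j < k) entry s (Some b) j =
    (odd i == b) && (s (inZp k) == Some b))%N.
Proof.
move=> W; elim: k => [|k IHk] /andP[].
  rewrite leqn0 => /eqP pi0 _; rewrite big_geq ?pi0 // -[in inZp 0%N]pi0 (sgsP i W).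
  by case: (b); case: odd.
rewrite leq_eqVlt => /predU1P[<- _|].
  by rewrite big_geq // (sgsP i W); case: (b); case: odd.
rewrite ltnS => le lt; rewrite big_nat_recr //= IHk ?le ?(ltnW lt) // /entry; clear IHk.
have := proj2 W i k; rewrite le lt => /(_ isT); rewrite /sgs -signr_odd.
case: (s (inZp k)) => [[]|]; case: (s (inZp k.+1)) => [[]|]; case: odd; case: b => //=.
all: by rewrite ?expr0 ?expr1 => H; exfalso; lra.
Qed.

Lemma wave_entry (R : realType) n (s : cstring n.+1) p i b :
  (forall i, p i < p i.+1)%N -> wave p (sgs R s) ->
  (\sum_(0 <= j < p i) entry s (Some b) j =
   \sum_(0 <= j < p 0) entry s (Some b) j + \sum_(j < i) (odd j == b))%N.
Proof.
move=> pS W; elim: i => [|i IHi]; first by rewrite big_ord0 addn0.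
rewrite big_ord_recr /= addnA -IHi (@big_cat_nat _ _ _ (p i) 0) ?(ltnW (pS i)) //=.
rewrite (wave_entry_in _ W) ?leqnn ?(ltnW (pS i)) // (sgsP i.+1 W) /=.
by case: (b); case: odd.
Qed.

Lemma sum_parity M b : (\sum_(j < 2 * M) (odd j == b) = M)%N.
Proof.
elim: M => [|M IHM]; first by rewrite muln0 big_ord0.
rewrite mulnS add2n 2!big_ord_recr /= IHM mul2n odd_double.
by case: (b); rewrite /= ?addn0 ?addn1.
Qed.

Lemma entry_periodic n (s : cstring n.+1) a j : entry s a (j + n.+1) = entry s a j.
Proof. by rewrite /entry -addSn !inZpDp. Qed.

Lemma sum_entry_periodic n (s : cstring n.+1) a k :
  (\sum_(0 <= j < k + n.+1) entry s a j =
   \sum_(0 <= j < n.+1) entry s a j + \sum_(0 <= j < k) entry s a j)%N.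
Proof.
by rewrite addnC; apply: big_nat_periodic => j; rewrite entry_periodic.
Qed.

Lemma wave_cellular (R : realType) M n (s : cstring n.+1) p :
  anchors M n.+1 p -> wave p (sgs R s) -> is_cellular M s.
Proof.
move=> A W.
have nc a : exists j, s j != a.
  case: (eqVneq (s (inZp (p 0%N))) a) => [<-|]; last by exists (inZp (p 0%N)).
  by exists (inZp (p 1%N)); rewrite (sgsP 1 W) (sgsP 0 W).
have nb b : nblocks s (Some b) = M.
  rewrite nblocks_entry //; apply/eqP.
  (* The period to count over is the one from [p 0] to [p (2 * M)], not the one from 0; the entries
     before [p 0] are therefore added to both sides. *)
  rewrite -(eqn_add2r (\sum_(0 <= j < p 0) entry s (Some b) j)) -sum_entry_periodic.
  by rewrite -(proj2 A) add0n (wave_entry _ _ (proj1 A) W) sum_parity addnC.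
apply/and3P; split; [exact/eqP/nb|exact/eqP/nb|].
apply/X_blocks_okP => // k l.
(* Shifting by [p 0] whole periods moves the run beyond [p 0], where the anchors can locate it. *)
rewrite -(inZpMDp _ (p 0%N)) => sk sj l0 sl.
have {}sj j : (0 < j <= l)%N -> s (inZp (k + p 0%N * n.+1 + j)) = sX.
  by move=> /sj; rewrite addnAC inZpMDp.
have {sl} : s (inZp (k + p 0%N * n.+1 + l.+1)) != sX.
  by rewrite addnAC inZpMDp.
have -> : s (inZp (k + l.+1)) = s (inZp (k + p 0%N * n.+1 + l.+1)).
  by rewrite addnAC inZpMDp.
set q := (k + p 0%N * n.+1)%N in sk sj *; move=> sl.
(* Anchors carry bits, so the run of X and its two flanking bits lie in a single segment. Equal
   flanking bits would then force the value 0 between them to equal 1 or -1. *)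
have pq : (p 0 <= q)%N by rewrite /q mulnS; lia.
have [i /andP[le lt]] := anchors_locate A (leqW pq).
have pnX m : s (inZp (p m)) != sX by rewrite (sgsP m W).
have {}le : (p i <= q)%N.
  move: le; rewrite leq_eqVlt => /predU1P[E|//].
  by have := pnX i; rewrite E -(addn1 q) sj ?eqxx.
have {}lt : (q + l.+1 <= p i.+1)%N.
  rewrite leqNgt; apply/negP => lt'.
  have := pnX i.+1; rewrite -(subnKC (ltnW lt)) addSnnS sj ?eqxx //; lia.
have l1 : (q.+1 <= q + l.+1)%N by lia.
have := wave_mono W (leqW le) l1 lt.
have := wave_mono W le (leqnSn q) (leq_trans l1 lt).
have := sj 1%N; rewrite addn1 l0 => /(_ isT) sq1.
rewrite /sgs sq1 mulr0; clear sq1.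
move: sk sl; case: (s (inZp q)) => [[]|] //; case: (s _) => [[]|] //= _ _.
all: by case: (sign_cases R i) => -> *; exfalso; lra.
Qed.

(** Bits of the larger string are kept in the smaller one, so both agree at the anchors [p]; the
    smaller one also has variation 4M per period, which forces it to be monotone in between. *)
Lemma str_lt_wave (R : realType) M n (s s' : cstring n.+1) p p' : (0 < M)%N ->
  anchors M n.+1 p -> anchors M n.+1 p' ->
  wave p (sgs R s) -> wave p' (sgs R s') -> str_lt s' s -> wave p (sgs R s').
Proof.
move=> M0 A A' W W' /andP[_ /forallP le].
apply: (wave_of_variation M0 A (sgsDp R s')).
  exact: wave_variation_period A' W' (sgsDp R s').
move=> i; apply/sg_bit; have := le (inZp (p i)).
by rewrite (sgsP i W) => /orP[/eqP|/andP[_ /eqP]].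
Qed.

Lemma cellular_bits M n (s : cstring n.+1) b k : (0 < M)%N -> is_cellular M s ->
  exists m, (k < m)%N && (s (inZp m) == Some b).
Proof.
move=> M0 /and3P[/eqP nb0 /eqP nb1 _].
have [j sj] : exists j, s j = Some b.
  by apply: nblocks_gt0; case: b; rewrite ?nb1 ?nb0.
exists (j + k.+1 * n.+1)%N; rewrite inZpMDp valZpK sj eqxx andbT.
by rewrite mulnS mulSn; lia.
Qed.

Lemma last_bit n (s : cstring n.+1) q k : (q <= k)%N -> s (inZp q) != sX ->
  s (inZp k) = sX -> exists m l, [/\ (q <= m)%N, k = (m + l)%N, (0 < l)%N, s (inZp m) != sX &
    forall j, (0 < j <= l)%N -> s (inZp (m + j)) = sX].
Proof.
move=> + sq; elim: k => [|k IHk].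
  by rewrite leqn0 => /eqP q0 sk; move: sq; rewrite q0 sk.
rewrite leq_eqVlt => /predU1P[<- sq'|]; first by rewrite sq' in sq.
rewrite ltnS => le sk; case: (eqVneq (s (inZp k)) sX) => [sk0|nsk].
  have [m [l [qm kE l0 sm H]]] := IHk le sk0.
  exists m, l.+1; split=> //; first by rewrite kE addnS.
  move=> j /andP[j0]; rewrite leq_eqVlt => /predU1P[->|]; first by rewrite addnS -kE.
  by rewrite ltnS => jl; apply: H; rewrite j0 jl.
exists k, 1%N; split=> //; first by rewrite addn1.
by move=> [|[|j]] //; rewrite addn1.
Qed.

Lemma sg_step (R : realType) i (a a' : symb) : a != Some (odd i) ->
  (a = sX -> a' != Some (~~ odd i)) -> 0 <= (-1) ^+ i * (sg R a - sg R a').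
Proof.
rewrite -signr_odd; case: a => [[]|]; case: a' => [[]|]; case: odd => //=.
all: by rewrite ?expr0 ?expr1 => ? H; first [lra | exfalso; have := H erefl].
Qed.

Lemma cellular_wave (R : realType) M n (s : cstring n.+1) : (0 < M)%N -> is_cellular M s ->
  exists p, [/\ (n.+1 <= p 0%N <= 2 * n.+1)%N, anchors M n.+1 p & wave p (sgs R s)].
Proof.
move=> M0 C; pose nx b k := ex_minn (cellular_bits b k M0 C).
have nxP b k : [/\ (k < nx b k)%N, s (inZp (nx b k)) = Some b &
    forall m, (k < m)%N -> s (inZp m) = Some b -> (nx b k <= m)%N].
  rewrite /nx; case: ex_minnP => m /andP[lt /eqP sm] mn; split=> // m' lt' sm'.
  by apply: mn; rewrite lt' sm' eqxx.
have nxD b k : nx b (k + n.+1)%N = (nx b k + n.+1)%N.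
  have [lt sn mn] := nxP b k; have [lt' sn' mn'] := nxP b (k + n.+1)%N.
  have ge : (n.+1 <= nx b (k + n.+1))%N by apply: leq_trans (ltnW lt'); rewrite leq_addl.
  apply/eqP; rewrite eqn_leq mn' ?ltn_add2r ?inZpDp //=.
  rewrite -[X in (_ <= X)%N](subnK ge) leq_add2r mn //; first by rewrite ltn_subRL addnC.
  by rewrite -sn' -[in RHS](subnK ge) inZpDp.
have [ba bb] : (exists j, s j = Some true) /\ (exists j, s j = Some false).
  have ex b : exists j, s j = Some b.
    by have [m /andP[_ /eqP sm]] := cellular_bits b 0 M0 C; exists (inZp m).
  by split; exact: ex.
have nc b : exists j, s j != Some b.
  by case: b; [case: bb => j sj|case: ba => j sj]; exists j; rewrite sj.
have ncX : exists j, s j != sX by case: ba => j sj; exists j; rewrite sj.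
have /and3P[_ /eqP nb1 /(X_blocks_okP ncX) flk] := C.
rewrite (nblocks_entry (nc true)) in nb1.
have [k0 ltk0 ent0] : exists2 k, (k < n.+1)%N & entry s (Some true) k.
  have : [exists k : 'I_n.+1, entry s (Some true) k].
    apply: contraPT (M0); rewrite negb_exists => /forallP ne; apply/negP.
    by rewrite -leqNgt -nb1 big_mkord big1 // => k _; rewrite (negbTE (ne k)).
  by move=> /existsP[k ek]; exists k.
(* Each anchor is the next occurrence of the opposite bit. The additional period at the start gives
   [n.+1 <= p 0], which later makes the phase at position 0 negative enough. *)
pose p := fix p i := if i is j.+1 then nx (odd j) (p j) else (k0 + n.+1).+1.
have p0E : p 0%N = (k0.+1 + n.+1)%N by [].
have pE i : p i.+1 = nx (odd i) (p i) by [].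
have sp i : s (inZp (p i)) = Some (~~ odd i).
  case: i => [|i]; last by rewrite pE /= negbK; have [] := nxP (odd i) (p i).
  by move: ent0 => /andP[_ /eqP]; rewrite p0E inZpDp.
have pS i : (p i < p i.+1)%N by rewrite pE; have [] := nxP (odd i) (p i).
have W : wave p (sgs R s).
  split=> [i|i k /andP[le lt]]; first exact/sg_bit.
  have ne m : (p i <= m < p i.+1)%N -> s (inZp m) != Some (odd i).
    move=> /andP[]; rewrite leq_eqVlt => /predU1P[<- _|ltm mlt].
      by rewrite sp; case: odd.
    apply: contraTN mlt => /eqP sm; rewrite -leqNgt pE.
    by have [_ _] := nxP (odd i) (p i); apply.
  have nk : s (inZp k) != Some (odd i) by apply: ne; rewrite le.
  (* The last bit before the run of X lies in the segment, so it is still [Some (~~ odd i)]; the run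
     has to end with the other bit. *)
  have nk1 : s (inZp k) = sX -> s (inZp k.+1) != Some (~~ odd i).
    move=> sk; have spX : s (inZp (p i)) != sX by rewrite sp.
    have [m [l [pm kE l0 sm H]]] := last_bit le spX sk.
    apply/eqP => sk1; have := flk m l sm H l0; rewrite addnS -kE sk1.
    move=> /(_ isT); apply/negP; rewrite negbK.
    have : s (inZp m) != Some (odd i) by apply: ne; rewrite pm; apply: leq_ltn_trans lt; lia.
    by move: sm; case: (s _) => [[]|] //; case: odd.
  exact: sg_step.
(* Periodicity of the anchors by counting: [p (2 * M)] and [p 0 + n.+1] both begin a block of 1,
   with equally many such beginnings up to them, so they coincide. *)
pose Cn k := (\sum_(0 <= j < k) entry s (Some true) j)%N.
have CS k : Cn k.+1 = (Cn k + entry s (Some true) k)%N by rewrite /Cn big_nat_recr.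
have Cm : {homo Cn : k l / (k <= l)%N}.
  by apply: homo_leq => // [k|k]; [exact: leq_trans|rewrite CS leq_addr].
have C2 : Cn (p (2 * M)%N) = Cn (p 0 + n.+1)%N.
  by rewrite /Cn sum_entry_periodic nb1 (wave_entry _ _ pS W) sum_parity addnC.
have strict k l : (k < l)%N -> entry s (Some true) l.-1 -> (Cn k < Cn l)%N.
  case: l => // l; rewrite ltnS /= => /Cm le e.
  by rewrite CS e addn1 ltnS.
have e1 : entry s (Some true) (p 0 + n.+1)%N.-1.
  by rewrite p0E !addSn /= !entry_periodic.
have e2 : entry s (Some true) (p (2 * M)%N).-1.
  have -> : (2 * M = (2 * M).-1.+1)%N by lia.
  rewrite pE.
  have -> : odd (2 * M).-1 by rewrite -[odd _]negbK -oddS prednK ?muln_gt0 // mul2n odd_double.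
  set q := p _; have sq : s (inZp q) = Some false.
    rewrite /q sp -oddS prednK ?muln_gt0 // mul2n odd_double //.
  have [lt sn mn] := nxP true q.
  rewrite /entry prednK ?(leq_ltn_trans _ lt) // sn eqxx andbT.
  have : (q <= (nx true q).-1)%N by lia.
  rewrite leq_eqVlt => /predU1P[<-|ltq]; first by rewrite sq.
  by apply/eqP => /(mn _ ltq); lia.
have per : p (2 * M)%N = (p 0 + n.+1)%N.
  case: (ltngtP (p (2 * M)%N) (p 0 + n.+1)%N) => // /strict.
    by move=> /(_ e1); rewrite C2 ltnn.
  by move=> /(_ e2); rewrite C2 ltnn.
exists p; split=> //; first by rewrite p0E; lia.
split=> //; elim=> [|i IHi] //; rewrite addSn !pE IHi nxD; congr (nx _ _ + _)%N.
by rewrite oddD mul2n odd_double addbF.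
Qed.

(** * From waves to points of the realization *)

Local Open Scope classical_set_scope.
Local Open Scope ring_scope.

(** The default values, 0 here and 1 in [upper], are the ends of the range of levels, so the
    interval from [lower z s] to [upper z s] never leaves that range. *)
Definition lower (R : realType) n (z : 'I_n.+1 -> R) (s : cstring n.+1) : R :=
  \big[Num.max/0]_(k | s k == None) `|z k|.

Definition upper (R : realType) n (z : 'I_n.+1 -> R) (s : cstring n.+1) : R :=
  \big[Num.min/1]_(k | s k != None) (sg R (s k) * z k).

(* [mass z s] is the length of the set of levels [u] in ]0, 1] at which cutting
   [z] by [threshold u] yields the string [s]. *)
Definition mass (R : realType) n (z : 'I_n.+1 -> R) : {ptws cstring n.+1 -> R} :=
  fun s => Num.max 0 (upper z s - lower z s).

(** The inequalities are non-strict so that at the top level 1 the extreme values 1 and -1 still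
    give bits. *)
Definition threshold (R : realType) (u x : R) : symb :=
  if u <= x then Some true else if x <= - u then Some false else None.

Definition cut (R : realType) n (u : R) (z : 'I_n.+1 -> R) : cstring n.+1 :=
  [ffun k => threshold u (z k)].

Definition coords (R : realType) n (x : {ptws cstring n.+1 -> R}) (k : 'I_n.+1) : R :=
  \sum_(s : cstring n.+1) x s * sg R (s k).

Lemma thresholdP (R : realType) (u x : R) a : 0 < u ->
  (threshold u x == a) = if a is Some _ then u <= sg R a * x else `|x| < u.
Proof.
move=> u0; rewrite /threshold; case: a => [[]|] /=; rewrite ?mul1r ?mulN1r.
- by case: leP => // _; case: leP.
- rewrite lerNr; case: (leP u x) => ux; last by case: leP.
  by symmetry; apply/negbTE; rewrite -ltNge; lra.
- rewrite ltr_norml; case: (leP u x) => ux; first by rewrite andbF.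
  by rewrite andbT; case: leP.
Qed.

Lemma cutP (R : realType) n (u : R) (z : 'I_n.+1 -> R) s : 0 < u <= 1 ->
  (cut u z == s) = (lower z s < u <= upper z s).
Proof.
move=> /andP[u0 u1]; apply/eqP/andP => [<-|[/bigmax_ltP[_ lo] /bigmin_geP[_ up]]].
  split.
    apply/bigmax_ltP; split=> // k; rewrite ffunE thresholdP //.
  apply/bigmin_geP; split=> // k; rewrite ffunE.
  have := eqxx (threshold u (z k)); rewrite thresholdP //.
  by case: (threshold u (z k)).
apply/ffunP => k; rewrite ffunE; apply/eqP; rewrite thresholdP //.
by case sk: (s k) => [b|]; [rewrite -sk; apply: up | apply: lo]; rewrite sk.
Qed.

Lemma lower_ge0 (R : realType) n (z : 'I_n.+1 -> R) s : 0 <= lower z s.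
Proof. exact: bigmax_ge_id. Qed.

Lemma upper_le1 (R : realType) n (z : 'I_n.+1 -> R) s : upper z s <= 1.
Proof. exact: bigmin_le_id. Qed.

Lemma mass_cut (R : realType) n (z : 'I_n.+1 -> R) s : mass z s != 0 ->
  exists2 u, 0 < u <= 1 & s = cut u z.
Proof.
rewrite /mass => ne; have lu : lower z s < upper z s.
  by rewrite ltNge; apply: contraNN ne => le; rewrite max_l // subr_le0.
have u01 : 0 < upper z s <= 1 by rewrite upper_le1 (le_lt_trans (lower_ge0 z s)).
by exists (upper z s) => //; apply/esym/eqP; rewrite cutP // lu lexx.
Qed.

(** Every level in ]0, 1] cuts out exactly one string, so the intervals []lower z s, upper z s]]
    partition ]0, 1]; the masses are their lengths, and Lebesgue measure is additive. *)
Lemma sum_mass (R : realType) n (z : 'I_n.+1 -> R) : \sum_s mass z s = 1.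
Proof.
pose D := [set` enum (cstring n.+1)] : set (cstring n.+1).
pose F (s : cstring n.+1) := [set` `]lower z s, upper z s]] : set R.
have muF s : lebesgue_measure (F s) = (mass z s)%:E.
  rewrite /F lebesgue_measure_itv /= lte_fin /mass; case: ltP => H.
    by rewrite -EFinB max_r // subr_ge0 ltW.
  by rewrite max_l // subr_le0.
have U : \bigcup_(s in D) F s = [set` `]0, 1]] :> set R.
  apply/seteqP; split=> u /=.
    move=> [s _]; rewrite /F /= !in_itv /= => /andP[lo up].
    by rewrite (le_lt_trans (lower_ge0 z s) lo) (le_trans up (upper_le1 z s)).
  rewrite in_itv /= => u01; exists (cut u z); first by rewrite /D /= mem_enum.
  by rewrite /F /= in_itv /= -cutP.
have : lebesgue_measure (\bigcup_(s in D) F s) = (\sum_(s \in D) lebesgue_measure (F s))%E.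
  apply: measure_fin_bigcup; [exact: finite_seq| |by move=> s _; exact: measurable_itv].
    move=> s t _ _ [u [su tu]].
    have u01 : 0 < u <= 1.
      have : (\bigcup_(s in D) F s) u by exists s => //; rewrite /D /= mem_enum.
      by rewrite U /= in_itv.
    by move: su tu; rewrite /F /= !in_itv /= -!cutP // => /eqP<- /eqP<-.
rewrite U lebesgue_measure_itv /= lte_fin ltr01 sube0 -fsbig_seq ?enum_uniq //.
rewrite big_enum /=; under eq_bigr do rewrite muF.
by rewrite sumEFin => -[].
Qed.

Lemma cut_comparable (R : realType) n (z : 'I_n.+1 -> R) u v : 0 < u -> u <= v ->
  cut u z = cut v z \/ str_lt (cut u z) (cut v z).
Proof.
move=> u0 uv; case: (eqVneq (cut u z) (cut v z)) => [->|ne]; [by left|right].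
rewrite /str_lt ne; apply/forallP => k; rewrite !ffunE /threshold.
case: (leP v (z k)) => H; first by rewrite (le_trans uv H) eqxx.
case: (leP (z k) (- v)) => H'; last by rewrite eqxx andbT; exact: orbN.
have -> : (u <= z k) = false by apply/negbTE; rewrite -ltNge; lra.
by have -> : (z k <= - u) by lra.
Qed.

Lemma cut_wave (R : realType) n (z : 'I_n.+1 -> R) p u : (forall i, p i < p i.+1)%N ->
  wave p (z \o inZp) -> 0 < u <= 1 -> wave p (sgs R (cut u z)).
Proof.
move=> pS W /andP[u0 u1].
have -> : sgs R (cut u z) = (sg R \o threshold u) \o (z \o inZp).
  by apply/funext => k; rewrite /sgs /= ffunE.
apply: wave_comp pS W => [x y _ xy _||] /=; rewrite /threshold.
- case: (leP u x) => ux; first by rewrite (le_trans ux xy).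
  case: (leP x (- u)) => xu; first by do 2?case: ifP => _ /=; lra.
  by case: ifP => _; [|rewrite ifF ?lexx //; apply/negbTE; rewrite -ltNge]; rewrite /=; lra.
- by rewrite u1.
- by rewrite ifF ?lerN2 ?u1 //; apply/negbTE; rewrite -ltNge; lra.
Qed.

Lemma mass_BStr (R : realType) M n (z : 'I_n.+1 -> R) p :
  anchors M n.+1 p -> wave p (z \o inZp) -> BStr M (mass z).
Proof.
move=> A W; split.
- by move=> s; rewrite le_max lexx.
- move=> s /mass_cut[u u01 ->].
  exact: wave_cellular A (cut_wave (proj1 A) W u01).
- exact: sum_mass.
- move=> s t /mass_cut[u /andP[u0 _] ->] /mass_cut[v /andP[v0 _] ->].
  case: (leP u v) => uv.
    by case: (cut_comparable z u0 uv) => H; [apply: Or31|apply: Or32].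
  by case: (cut_comparable z v0 (ltW uv)) => H; [apply: Or31|apply: Or33].
Qed.

Lemma str_lt_bit N (s t : cstring N) k : str_lt s t -> t k != None -> s k = t k.
Proof.
by move=> /andP[_ /forallP/(_ k)] /orP[/eqP//|/andP[_ /eqP->]].
Qed.

Lemma str_lt_X N (s t : cstring N) k : str_lt s t -> s k = None -> t k = None.
Proof.
by move=> /andP[_ /forallP/(_ k)] /orP[/eqP<-//|/andP[_ /eqP->]].
Qed.

Lemma sg_sqr (R : realType) a : a != None -> sg R a * sg R a = 1.
Proof. by case: a => [[]|] //= _; ring. Qed.

Lemma sg_norm_le1 (R : realType) a : `|sg R a| <= 1.
Proof. by case: a => [[]|] /=; rewrite ?normrN ?normr1 ?normr0 ?ler01. Qed.

(** Both families sum to 1, so one inequality suffices. Let L be the total weight of the strings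
    below [s]. At an X of [s] the larger strings have X too, hence [lower] is at most L; at a bit of
    [s] the strings below agree with [s] and no larger string has the opposite bit, hence [upper] is
    at least L + x s. *)
Lemma mass_coords (R : realType) M n (x : {ptws cstring n.+1 -> R}) :
  BStr M x -> mass (coords x) = x.
Proof.
move=> [x0 xS x1 xC].
have ge s : x s <= mass (coords x) s.
  have [->|xs] := eqVneq (x s) 0; first by rewrite le_max lexx.
  rewrite le_max; apply/orP; right.
  pose L := \sum_t x t * (str_lt t s)%:R.
  have lo : lower (coords x) s <= L.
    apply/bigmax_leP; split; first by apply: sumr_ge0 => t _; rewrite mulr_ge0.
    move=> k /eqP sk; apply: le_trans (ler_norm_sum _ _ _) _.
    apply: ler_sum => t _; rewrite normrM (ger0_norm (x0 t)).
    have [->|xt] := eqVneq (x t) 0; first by rewrite !mul0r.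
    apply: ler_wpM2l => //; case: (xC _ _ xs xt) => [<-|st|->].
    + by rewrite sk /= normr0.
    + by rewrite (str_lt_X st sk) /= normr0.
    + exact: sg_norm_le1.
  have up : L + x s <= upper (coords x) s.
    have E : L + x s = \sum_t x t * (str_lt t s || (t == s))%:R.
      rewrite /L (bigD1 s) //= [in RHS](bigD1 s) //= /str_lt eqxx /= mulr0 mulr1 add0r addrC.
      by congr (_ + _); apply: eq_bigr => t /negbTE ->; rewrite orbF.
    apply/bigmin_geP; split.
      rewrite E -[leRHS]x1; apply: ler_sum => t _.
      by rewrite ler_piMr // lern1 leq_b1.
    move=> k sk; rewrite E mulr_sumr; apply: ler_sum => t _.
    have [->|xt] := eqVneq (x t) 0; first by rewrite !mul0r mulr0.
    rewrite mulrCA; apply: ler_wpM2l => //.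
    case: (xC _ _ xs xt) => [<-|st|ts].
    + by rewrite eqxx orbT sg_sqr.
    + have -> : (str_lt t s || (t == s)) = false.
        apply/negbTE; apply/norP; split; last by move: st => /andP[+ _]; rewrite eq_sym.
        apply/negP => ts; have /andP[/eqP + _] := st; apply; apply/ffunP => j.
        case: (eqVneq (t j) None) => [tj|/(str_lt_bit st) //].
        by rewrite tj; exact: str_lt_X ts tj.
      case: (eqVneq (t k) None) => [->|tk]; first by rewrite /= mulr0.
      by rewrite (str_lt_bit st tk) sg_sqr.
    + by rewrite ts /= (str_lt_bit ts sk) sg_sqr.
  lra.
apply/funext => s; apply/eqP; rewrite -subr_eq0; apply/eqP.
apply: (psumr_eq0P (P := predT) (F := fun t => mass (coords x) t - x t)) => //.
  by move=> t _; rewrite subr_ge0.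
by rewrite sumrB sum_mass x1 subrr.
Qed.

(** * The map to the circle *)

Lemma str_lt_card N (s t : cstring N) : str_lt s t ->
  (#|[pred k | s k == None]| < #|[pred k | t k == None]|)%N.
Proof.
move=> st; apply: proper_card; apply/properP; split.
  by apply/fintype.subsetP => k; rewrite !inE => /eqP/(str_lt_X st) ->.
have /andP[ne _] := st.
have /existsP[k] : [exists k, s k != t k].
  apply: contraNT ne; rewrite negb_exists => /forallP H; apply/eqP/ffunP => k.
  by apply/eqP; have := H k; rewrite negbK.
move=> stk; exists k; rewrite !inE.
  by apply: contraNT stk => /(str_lt_bit st) ->.
by apply: contraNN stk => /eqP sk; rewrite sk (str_lt_X st sk).
Qed.

(* The anchors come from the maximal string of the chain: its bits are shared by
   every string of the chain. *)
Lemma BStr_wave (R : realType) M n (x : {ptws cstring n.+1 -> R}) : (0 < M)%N ->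
  BStr M x -> exists p, [/\ (n.+1 <= p 0%N <= 2 * n.+1)%N, anchors M n.+1 p,
    forall s, x s != 0 -> wave p (sgs R s) & wave p (coords x \o inZp)].
Proof.
move=> M0 [x0 xS x1 xC].
have [s0 xs0] : exists s, x s != 0.
  apply/existsP; apply: contraT; rewrite negb_exists => /forallP H.
  move: x1; rewrite big1 => [/esym/eqP|s _]; first by rewrite oner_eq0.
  by have := H s; rewrite negbK => /eqP.
have [s xs smax] := @arg_maxnP _ s0 (fun s => x s != 0)
  (fun s : cstring n.+1 => #|[pred k | s k == None]|) xs0.
have [p [p0 A W]] := cellular_wave R M0 (xS _ xs).
have Wt t : x t != 0 -> wave p (sgs R t).
  move=> xt; case: (xC _ _ xs xt) => [<-//|st|ts].
    by have := leq_ltn_trans (smax t xt) (str_lt_card st); rewrite ltnn.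
  have [p' [_ A' W']] := cellular_wave R M0 (xS _ xt).
  exact: str_lt_wave M0 A A' W W' ts.
exists p; split=> //; exact: (wave_sum (w := fun s => sgs R s) x0 x1 Wt).
Qed.

(* Positive when the symbols pass from 1 to 0 across the block of X at position 0;
   the bit ending that block decides. *)
Definition direction (R : realType) n (s : cstring n.+1) : R :=
  if s ord0 is Some _ then 0 else - sg R (s (inZp (runlen s None ord0))).

Definition drift (R : realType) n (x : {ptws cstring n.+1 -> R}) : R :=
  \sum_(s : cstring n.+1) x s * direction R s.

(* This is exp(i pi g) for the phase g of the wave at position 0, see [BStr_phase];
   in terms of the linear functions [coords] and [drift] no choice of a branch of
   the phase is involved. *)
Definition toCircle (R : realType) n (x : {ptws cstring n.+1 -> R}) : (R * R)%type :=
  (sin (pi / 2 * coords x ord0), sin (pi / 2 * drift x)).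

(** Position 0 is examined at its copy [m * n.+1], located in segment [i]. A run of X starting there
    stops at the latest at the anchor [p i.+1], so by monotonicity the bit that stops it is the one
    towards which the segment runs. *)
Lemma direction_wave (R : realType) M n (s : cstring n.+1) p i m :
  anchors M n.+1 p -> wave p (sgs R s) -> (p i <= m * n.+1 < p i.+1)%N ->
  direction R s = (-1) ^+ i * (1 - `|sg R (s ord0)|).
Proof.
move=> A W /andP[le lt]; rewrite /direction.
have E k : s (inZp k) = s (inZp (m * n.+1 + k)) by rewrite addnC inZpMDp.
have E0 : ord0 = inZp 0 :> 'I_n.+1 by apply: val_inj; rewrite /= mod0n.
case s0: (s ord0) => [b|].
  by case: b s0 => _ /=; rewrite ?normrN normr1 subrr mulr0.
rewrite /= normr0 subr0 mulr1.
have nc : exists j, s j != None by exists (inZp (p 0%N)); rewrite (sgsP 0 W).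
set r := runlen _ _ _.
have rP : s (inZp r) != None by have := runlenP nc ord0; rewrite add0n.
have rlt : (m * n.+1 + r <= p i.+1)%N.
  rewrite leqNgt; apply/negP => H.
  have H' : (p i.+1 - m * n.+1 < r)%N by lia.
  have := runlen_min nc H'; rewrite add0n E subnKC ?(ltnW lt) //.
  by rewrite (sgsP i.+1 W).
have := wave_mono W le (leq_addr r _) rlt.
rewrite /sgs -E -[(m * n.+1)%N]addn0 -E -E0 s0 /= mulr0.
by case: (s (inZp r)) rP => [[]|] //= _; case: (sign_cases R i) => ->; lra.
Qed.

(** There is no cancellation: two strings of a chain never carry opposite bits at the same
    position. *)
Lemma coords_norm (R : realType) M n (x : {ptws cstring n.+1 -> R}) k : BStr M x ->
  \sum_(s : cstring n.+1) x s * `|sg R (s k)| = `|coords x k|.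
Proof.
move=> [x0 xS x1 xC].
have [e e1 H] : exists2 e : R, `|e| = 1 & forall s, x s != 0 -> `|sg R (s k)| = e * sg R (s k).
  case: (pselect (exists2 s, x s != 0 & s k != None)) => [[s xs sk]|ne].
    exists (sg R (s k)); first by case: (s k) sk => [[]|] //= _; rewrite ?normrN normr1.
    move=> t xt; have [->|tk] := eqVneq (t k) None; first by rewrite /= normr0 mulr0.
    have -> : s k = t k.
      by case: (xC _ _ xs xt) => [->//|/str_lt_bit/(_ tk)//|/str_lt_bit/(_ sk)].
    by case: (t k) tk => [[]|] //= _; rewrite ?normrN normr1; ring.
  exists 1; first exact: normr1.
  move=> s xs; have [->|sk] := eqVneq (s k) None; first by rewrite /= normr0 mulr0.
  by case: ne; exists s.
have -> : `|coords x k| = `|e * coords x k| by rewrite normrM e1 mul1r.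
have <- : \sum_(s : cstring n.+1) x s * `|sg R (s k)| = e * coords x k.
  rewrite /coords mulr_sumr; apply: eq_bigr => s _.
  by have [->|/H->] := eqVneq (x s) 0; rewrite ?mul0r ?mulr0 // mulrCA.
by rewrite ger0_norm // sumr_ge0 // => s _; rewrite mulr_ge0.
Qed.

Lemma drift_wave (R : realType) M n (x : {ptws cstring n.+1 -> R}) p i m :
  BStr M x -> anchors M n.+1 p -> (forall s, x s != 0 -> wave p (sgs R s)) ->
  (p i <= m * n.+1 < p i.+1)%N ->
  drift x = (-1) ^+ i * (1 - `|coords x ord0|).
Proof.
move=> xB A W H; rewrite -(coords_norm _ xB); have [_ _ x1 _] := xB.
rewrite -[X in X - _]x1 -sumrB mulr_sumr; apply: eq_bigr => s _.
have [->|xs] := eqVneq (x s) 0; first by rewrite !mul0r subrr mulr0.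
by rewrite (direction_wave A (W _ xs) H); ring.
Qed.

(** The argument is pi times the phase of value [z] in segment [i]. Its cosine forgets [i]
    altogether and its sine retains only the sign [(-1) ^+ i]; this is why [coords] and [drift]
    suffice to define [toCircle]. *)
Lemma cos_phase (R : realType) i (z : R) :
  cos (pi * (i%:R + (1 - (-1) ^+ i * z) / 2)) = sin (pi / 2 * z).
Proof.
have -> : pi * (i%:R + (1 - (-1) ^+ i * z) / 2) = (pi / 2 - (-1) ^+ i * (pi / 2 * z)) + pi *+ i.
  by rewrite -[pi *+ i]mulr_natr; field.
rewrite (alternatingn (@cosDpi R)) cosB cos_pihalf sin_pihalf.
by case: (sign_cases R i) => ->; rewrite ?mul1r ?mulN1r ?sinN; ring.
Qed.

Lemma sin_phase (R : realType) i (z : R) :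
  sin (pi * (i%:R + (1 - (-1) ^+ i * z) / 2)) = (-1) ^+ i * cos (pi / 2 * z).
Proof.
have -> : pi * (i%:R + (1 - (-1) ^+ i * z) / 2) = (pi / 2 - (-1) ^+ i * (pi / 2 * z)) + pi *+ i.
  by rewrite -[pi *+ i]mulr_natr; field.
rewrite (alternatingn (@sinDpi R)) sinB cos_pihalf sin_pihalf.
by case: (sign_cases R i) => ->; rewrite ?mul1r ?mulN1r ?cosN; ring.
Qed.

Lemma sin_halfpi_drift (R : realType) i (z : R) :
  sin (pi / 2 * ((-1) ^+ i * (1 - `|z|))) = (-1) ^+ i * cos (pi / 2 * z).
Proof.
have -> : cos (pi / 2 * z) = sin (pi / 2 * (1 - `|z|)).
  rewrite mulrBr mulr1 sinB sin_pihalf cos_pihalf -cos_norm normrM.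
  by rewrite [`|pi / 2|]ger0_norm ?divr_ge0 ?pi_ge0 //; ring.
by case: (sign_cases R i) => ->; rewrite ?mul1r // !mulN1r mulrN sinN.
Qed.

Lemma cos_period (R : realType) (y : R) m : cos (pi * (y + 2 * m%:R)) = cos (pi * y).
Proof.
have -> : pi * (y + 2 * m%:R) = pi * y + (pi *+ 2) *+ m.
  by rewrite -[_ *+ m]mulr_natr -[pi *+ 2]mulr_natr; ring.
by rewrite (periodicn (@cosD2pi R)).
Qed.

Lemma sin_period (R : realType) (y : R) m : sin (pi * (y + 2 * m%:R)) = sin (pi * y).
Proof.
have -> : pi * (y + 2 * m%:R) = pi * y + (pi *+ 2) *+ m.
  by rewrite -[_ *+ m]mulr_natr -[pi *+ 2]mulr_natr; ring.
by rewrite (periodicn (@sinD2pi R)).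
Qed.

Lemma wave_phase (R : realType) p (z : nat -> R) M N i k : anchors M N p -> wave p z ->
  (p i <= k <= p i.+1)%N ->
  (variation z k - variation z (p 0%N)) / 2 = i%:R + (1 - (-1) ^+ i * z k) / 2.
Proof.
by move=> A W H; rewrite (wave_variation_in W H) (wave_variation i A W); field.
Qed.

Lemma BStr_phase (R : realType) M n (x : {ptws cstring n.+1 -> R}) p
    (g := fun k => (variation (coords x \o inZp) k - variation (coords x \o inZp) (p 0%N)) / 2) :
  BStr M x -> anchors M n.+1 p -> (p 0 <= 2 * n.+1)%N ->
  (forall s, x s != 0 -> wave p (sgs R s)) -> wave p (coords x \o inZp) ->
  toCircle x = (cos (pi * g 0%N), sin (pi * g 0%N)) /\
  forall k, cos (pi * g k) = sin (pi / 2 * coords x (inZp k)).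
Proof.
move=> xB A p0 Ws W; set z := coords x \o inZp in g W *.
have zper j : z (j + n.+1)%N = z j by rewrite /z /= inZpDp.
have gper k : g (k + 2 * n.+1)%N = g k + 2 * (2 * M)%:R.
  rewrite /g mul2n -addnn addnA !variation_periodic //.
  by rewrite (wave_variation_period A W zper) natrM; field.
(* Position [k] may precede [p 0]. Two periods later it no longer does, and the phase has grown by a
   multiple of 2, which sine and cosine do not see. *)
have loc k : exists i, (p i <= k + 2 * n.+1 < p i.+1)%N.
  by apply: (anchors_locate A); apply: leq_trans p0 (leq_addl _ _).
have zper2 k : z (k + 2 * n.+1)%N = z k by rewrite /z /= inZpMDp.
have gseg k i : (p i <= k + 2 * n.+1 < p i.+1)%N ->
    g (k + 2 * n.+1)%N = i%:R + (1 - (-1) ^+ i * z k) / 2.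
  move=> /andP[le lt]; rewrite /g (wave_phase (i := i) A W) ?zper2 //.
  by rewrite le ltnW.
have gcos k : cos (pi * g k) = sin (pi / 2 * coords x (inZp k)).
  have [i H] := loc k.
  by rewrite -(cos_period _ (2 * M)) -gper (gseg _ _ H) cos_phase.
split=> //; have E0 : ord0 = inZp 0 :> 'I_n.+1 by apply: val_inj; rewrite /= mod0n.
rewrite /toCircle; congr pair; first by rewrite gcos E0.
have [i H] := loc 0%N.
rewrite -(sin_period _ (2 * M)) -gper (gseg _ _ H) sin_phase.
by rewrite (drift_wave xB A Ws (i := i) (m := 2)) // sin_halfpi_drift E0.
Qed.

(** * Phases *)

Definition clamp (R : realType) (x : R) : R := Num.max (-1) (Num.min 1 x).

Lemma clampP (R : realType) (x : R) :
  (x <= -1 /\ clamp x = -1) \/ (-1 <= x <= 1 /\ clamp x = x) \/ (1 <= x /\ clamp x = 1).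
Proof.
rewrite /clamp /Order.max /Order.min.
case: (ltP 1 x) => H1; case: ltP => H2; [right; right|left|right; left|left]; split; lra.
Qed.

Lemma clamp_le (R : realType) (x y : R) : x <= y -> clamp x <= clamp y.
Proof. by have := clampP x; have := clampP y; lra. Qed.

Lemma clamp_bound (R : realType) (x : R) : -1 <= clamp x <= 1.
Proof. by have := clampP x; lra. Qed.

Lemma clamp_sign (R : realType) i (x : R) : (-1) ^+ i * clamp x = clamp ((-1) ^+ i * x).
Proof.
have := clampP x; have := clampP ((-1) ^+ i * x).
by case: (sign_cases R i) => ->; lra.
Qed.

(* kappa is chosen so that every phase between a wave and the uniform one comes
   within kappa of each integer; lambda makes [squash] constant there. *)
Definition kappa (R : realType) (M N : nat) : R :=
  1 / 2 - (1 - 2 * M%:R / N%:R) / (16 * M%:R).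

Definition lambda (R : realType) (M N : nat) : R := (cos (pi * kappa R M N))^-1.

Definition squash (R : realType) M N (y : R) : R := clamp (lambda R M N * cos (pi * y)).

Lemma ratio_bound (R : realType) M N : (0 < M)%N -> (2 * M < N)%N ->
  0 < 2 * M%:R / N%:R :> R /\ 2 * M%:R / N%:R < 1 :> R.
Proof.
move=> M0 MN; have N0 : 0 < N%:R :> R by rewrite ltr0n; lia.
have M0' : 0 < M%:R :> R by rewrite ltr0n.
split; first by rewrite divr_gt0 // mulr_gt0.
by rewrite ltr_pdivrMr // mul1r -natrM ltr_nat.
Qed.

Lemma kappa_bound (R : realType) M N : (0 < M)%N -> (2 * M < N)%N ->
  1 / 4 <= kappa R M N < 1 / 2.
Proof.
move=> M0 MN; have [r0 r1] := ratio_bound R M0 MN.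
have M1 : 1 <= M%:R :> R by rewrite ler1n.
rewrite /kappa; set r := 2 * M%:R / N%:R in r0 r1 *.
have a0 : 0 < (1 - r) / (16 * M%:R) by rewrite divr_gt0 //; lra.
have a1 : (1 - r) / (16 * M%:R) <= 1 / 4.
  by rewrite ler_pdivrMr; lra.
by apply/andP; split; lra.
Qed.

Lemma cos_le_cos (R : realType) (x y : R) : 0 <= x -> x <= y -> y <= pi -> cos y <= cos x.
Proof.
move=> x0 xy yp; rewrite le_eqVlt; have [->|ne] := eqVneq x y; first by rewrite eqxx.
rewrite (ltr_cos (R := R)) ?in_itv /= ?x0 ?yp ?(le_trans x0 xy) ?(le_trans xy yp) //.
by rewrite lt_neqAle ne xy orbT.
Qed.

Lemma lambda_gt0 (R : realType) M N : (0 < M)%N -> (2 * M < N)%N ->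
  0 < cos (pi * kappa R M N) /\ 0 < lambda R M N.
Proof.
move=> M0 MN; have /andP[k0 k1] := kappa_bound R M0 MN.
have c0 : 0 < cos (pi * kappa R M N).
  have p0 := pi_gt0 R; apply: cos_gt0_pihalf; apply/andP; split; nra.
by split=> //; rewrite /lambda invr_gt0.
Qed.

Lemma cos_shift (R : realType) (y : R) i :
  cos (pi * y) = (-1) ^+ i * cos (pi * (y - i%:R)).
Proof.
rewrite -(alternatingn (@cosDpi R)); congr cos.
by rewrite -[pi *+ i]mulr_natr; ring.
Qed.

Lemma squash_sign (R : realType) M N i (y : R) :
  (-1) ^+ i * squash M N y = squash M N (y - i%:R).
Proof.
rewrite /squash clamp_sign (cos_shift _ i) mulrCA mulrA [_ * _ ^+ i * _]mulrC.
by congr clamp; case: (sign_cases R i) => ->; ring.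
Qed.

Lemma squash_near (R : realType) M N (i : nat) (y : R) : (0 < M)%N -> (2 * M < N)%N ->
  `|y - i%:R| <= kappa R M N -> squash M N y = (-1) ^+ i.
Proof.
move=> M0 MN near; have /andP[k0 k1] := kappa_bound R M0 MN.
have [c0 l0] := lambda_gt0 R M0 MN.
suff H : squash M N (y - i%:R) = 1.
  by move: H; rewrite -squash_sign; case: (sign_cases R i) => ->; lra.
rewrite /squash.
suff : 1 <= lambda R M N * cos (pi * (y - i%:R)).
  by have := clampP (lambda R M N * cos (pi * (y - i%:R))); lra.
rewrite /lambda mulrC ler_pdivlMr // mul1r -[leRHS]cos_norm normrM ger0_norm ?pi_ge0 //.
have p0 := pi_gt0 R.
by apply: cos_le_cos; [rewrite mulr_ge0 ?pi_ge0|rewrite ler_wpM2l ?pi_ge0|nra].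
Qed.

(** The cosine is monotone only from [i] to [i.+1]; in the margin of width kappa on either side
    [squash] already has its extreme value, which can only help. *)
Lemma squash_anti (R : realType) M N (i : nat) (y y' : R) : (0 < M)%N -> (2 * M < N)%N ->
  i%:R - kappa R M N <= y -> y <= y' -> y' <= i.+1%:R + kappa R M N ->
  (-1) ^+ i * squash M N y' <= (-1) ^+ i * squash M N y.
Proof.
move=> M0 MN iy yy yi; have /andP[k0 k1] := kappa_bound R M0 MN.
have [c0 l0] := lambda_gt0 R M0 MN.
have b (w : R) : -1 <= (-1) ^+ i * squash M N w <= 1 by rewrite squash_sign clamp_bound.
have /andP[b1 _] := b y; have /andP[_ b2] := b y'.
case: (leP y i%:R) => yi0.
  rewrite (@squash_near R M N i y) //; last by rewrite ler_norml; apply/andP; split; lra.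
  by case: (sign_cases R i) b1 b2 => -> b1 b2; lra.
case: (leP i.+1%:R y') => yi1.
  rewrite (@squash_near R M N i.+1 y') //; last by rewrite ler_norml; apply/andP; split; lra.
  by rewrite exprS; case: (sign_cases R i) b1 b2 => -> b1 b2; lra.
rewrite !squash_sign; apply: clamp_le; apply: ler_wpM2l; first exact: ltW.
rewrite -natr1 in yi1; have p0 := pi_gt0 R.
apply: cos_le_cos; [rewrite mulr_ge0 ?pi_ge0 //; lra| |nra].
by rewrite ler_wpM2l ?pi_ge0 //; lra.
Qed.

Lemma phase_mono (R : realType) (phi : nat -> R) k l :
  (forall k, phi k <= phi k.+1) -> (k <= l)%N -> phi k <= phi l.
Proof.
move=> H; elim: l => [|l IHl]; first by rewrite leqn0 => /eqP->.
rewrite leq_eqVlt => /predU1P[->//|]; rewrite ltnS => /IHl kl.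
exact: le_trans kl (H l).
Qed.

Lemma phase_wave (R : realType) M N (phi : nat -> R) : (0 < M)%N -> (2 * M < N)%N ->
  (forall k, phi k <= phi k.+1) -> (forall k, phi (k + N)%N = phi k + 2 * M%:R) ->
  phi 0%N < - kappa R M N -> (forall i : nat, exists k, `|phi k - i%:R| <= kappa R M N) ->
  exists p, [/\ anchors M N p, wave p (squash M N \o phi) &
    forall i, `|phi (p i) - i%:R| <= kappa R M N].
Proof.
move=> M0 MN phiS phiN phi0 hit; have /andP[k0 k1] := kappa_bound R M0 MN.
have mono k l : (k <= l)%N -> phi k <= phi l by exact: phase_mono.
have ex i : exists k, i%:R - kappa R M N <= phi k.
  by have [k] := hit i; rewrite ler_norml => /andP[? ?]; exists k; lra.
(* The first position whose phase reaches i - kappa. By [hit] its phase is at most i + kappa, and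
   kappa < 1/2 separates the anchors of successive integers. *)
pose p i := ex_minn (ex i).
have pP i : i%:R - kappa R M N <= phi (p i) /\
    forall k, i%:R - kappa R M N <= phi k -> (p i <= k)%N.
  by rewrite /p; case: ex_minnP.
have near i : `|phi (p i) - i%:R| <= kappa R M N.
  have [lo mn] := pP i; have [k] := hit i; rewrite ler_norml => /andP[h1 h2].
  have pk : (p i <= k)%N by apply: mn; lra.
  by have := mono _ _ pk; rewrite ler_norml => ?; apply/andP; split; lra.
have pS i : (p i < p i.+1)%N.
  rewrite ltnNge; apply/negP => /mono H.
  by have := near i; have [] := pP i.+1; rewrite -natr1 ler_norml => ? _ /andP[_ ?]; lra.
exists p; split=> //.
- split=> // i; have [lo mn] := pP i; have [lo' mn'] := pP (i + 2 * M)%N.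
  apply/eqP; rewrite eqn_leq mn' /=; last by rewrite phiN natrD natrM; lra.
  set q := p _ in lo' *.
  (* Because the phase starts below -kappa, it is below 2M - kappa at position N; so this anchor is
     at least N and can be moved back by one period. *)
  have Nq : (N <= q)%N.
    rewrite leqNgt; apply/negP => /ltnW/mono.
    have := phiN 0%N; rewrite add0n => ->; move: lo'; rewrite natrD natrM.
    by have := ler0n R i; lra.
  rewrite -(subnK Nq) leq_add2r mn //.
  by move: lo'; rewrite -{1}(subnK Nq) phiN natrD natrM; lra.
- split=> [i|i k /andP[le lt]] /=; first exact: squash_near.
  rewrite mulrBr subr_ge0; apply: squash_anti => //.
  + by apply: le_trans (mono _ _ le); have [] := pP i.
  + apply: le_trans (mono _ _ lt) _.
    by have := near i.+1; rewrite ler_norml => /andP[_ ?]; lra.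
Qed.

(** The step by which the phase first reaches [i] has length at most 2 kap, so one of its two ends
    is within kap of [i]. *)
Lemma phase_hits (R : realType) M N (phi : nat -> R) (kap : R) (i : nat) : (0 < M)%N ->
  (forall k, phi (k + N)%N = phi k + 2 * M%:R) -> phi 0%N < 0 ->
  (forall k, phi k.+1 <= phi k + 2 * kap) -> exists k, `|phi k - i%:R| <= kap.
Proof.
move=> M0 phiN phi0 step.
have M1 : 1 <= M%:R :> R by rewrite ler1n.
have mul m : phi (m * N)%N = phi 0%N + 2 * M%:R * m%:R.
  elim: m => [|m IHm]; first by rewrite mul0n mulr0 addr0.
  by rewrite mulSn addnC phiN IHm -natr1; ring.
have ex : exists k, i%:R <= phi k.
  have [m Hm] : exists m : nat, i%:R - phi 0%N <= m%:R.
    exists (Num.bound (i%:R - phi 0%N)); apply/ltW/archi_boundP.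
    by have := ler0n R i; lra.
  exists (m * N)%N; rewrite mul; have := ler0n R m; nra.
have [k ik kmin] := ex_minnP ex; case: k ik kmin => [|k] ik kmin.
  by have := ler0n R i; lra.
have ki : phi k < i%:R.
  by rewrite ltNge; apply/negP => /kmin; rewrite ltnn.
have := step k; case: (leP (i%:R - phi k) kap) => H S.
  by exists k; rewrite ler_norml; apply/andP; split; lra.
by exists k.+1; rewrite ler_norml; apply/andP; split; lra.
Qed.

Lemma uniform_phase_wave (R : realType) M N (a : R) : (0 < M)%N -> (2 * M < N)%N ->
  a <= -1 -> exists p, [/\ anchors M N p,
    wave p (squash M N \o (fun k => a + 2 * M%:R / N%:R * k%:R)) &
    forall i, `|a + 2 * M%:R / N%:R * (p i)%:R - i%:R| <= kappa R M N].
Proof.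
move=> M0 MN a1; have /andP[k0 k1] := kappa_bound R M0 MN.
have [r0 r1] := ratio_bound R M0 MN.
have N0 : N%:R != 0 :> R by rewrite pnatr_eq0; lia.
have M1 : 1 <= M%:R :> R by rewrite ler1n.
have per k : a + 2 * M%:R / N%:R * (k + N)%N%:R = a + 2 * M%:R / N%:R * k%:R + 2 * M%:R :> R.
  by rewrite natrD; field.
apply: (@phase_wave R M N (fun k => a + 2 * M%:R / N%:R * k%:R)) => //.
- by move=> k; rewrite -natr1; lra.
- by rewrite mulr0; lra.
- move=> i; apply: (phase_hits _ M0 per); first by rewrite mulr0; lra.
  move=> k; rewrite -natr1; suff : 2 * M%:R / N%:R <= 2 * kappa R M N by lra.
  rewrite /kappa; set r := 2 * M%:R / N%:R in r0 r1 *.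
  suff : (1 - r) / (16 * M%:R) <= (1 - r) / 2 by lra.
  have l0 : 0 <= 1 - r by lra.
  by apply: ler_wpM2l => //; rewrite lef_pV2 ?posrE; lra.
Qed.

Lemma periodic_bound (R : realType) M N p (z : nat -> R) k : (0 < N)%N ->
  anchors M N p -> wave p z -> (forall j, z (j + N)%N = z j) -> -1 <= z k <= 1.
Proof.
move=> N0 A W zN; have zm m : z (k + m * N)%N = z k.
  by elim: m => [|m IHm]; rewrite ?addn0 // mulSn addnCA addnC zN.
rewrite -(zm (p 0%N)); apply: (wave_bound A W).
by apply: leq_trans (leq_addl _ _); rewrite leq_pmulr.
Qed.

(** Both terms start at 0, are nondecreasing and gain 2M per period, so their difference never
    exceeds 2M. *)
Lemma variation_uniform (R : realType) M N (z : nat -> R) k : (0 < N)%N ->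
  (forall j, z (j + N)%N = z j) -> variation z N = 4 * M%:R ->
  `|variation z k / 2 - 2 * M%:R / N%:R * k%:R| <= 2 * M%:R.
Proof.
move=> N0 zN VN.
have N0' : 0 < N%:R :> R by rewrite ltr0n.
have NN : N%:R != 0 :> R by rewrite gt_eqF.
have M0 := ler0n R M.
have Vm m r : variation z (m * N + r)%N = variation z r + 4 * M%:R * m%:R.
  elim: m => [|m IHm]; first by rewrite mulr0 addr0.
  rewrite mulSn -addnA addnC variation_periodic // IHm VN -natr1; ring.
rewrite {1 2}(divn_eq k N) Vm natrD natrM.
set r := (k %% N)%N; set q := (k %/ N)%N.
have rN : (r <= N)%N by rewrite ltnW // ltn_pmod.
have V1 : variation z r <= 4 * M%:R by rewrite -VN variation_mono.
have V0 : 0 <= variation z r by rewrite /variation sumr_ge0.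
have -> : (variation z r + 4 * M%:R * q%:R) / 2 - 2 * M%:R / N%:R * (q%:R * N%:R + r%:R)
   = variation z r / 2 - 2 * M%:R * (r%:R / N%:R) by field.
have r0 : 0 <= r%:R / N%:R :> R by rewrite divr_ge0.
have r1 : r%:R / N%:R <= 1 :> R by rewrite ler_pdivrMr // mul1r ler_nat.
by rewrite ler_norml; apply/andP; split; nra.
Qed.

Lemma interp_phase_wave (R : realType) M N (z : nat -> R) p (t : R)
    (g := fun k => (variation z k - variation z (p 0%N)) / 2) :
  (0 < M)%N -> (2 * M < N)%N -> (forall j, z (j + N)%N = z j) ->
  anchors M N p -> wave p z -> (N <= p 0)%N -> 0 <= t <= 1 ->
  exists q, anchors M N q /\
    wave q (squash M N \o (fun k => (1 - t) * g k + t * (g 0%N + 2 * M%:R / N%:R * k%:R))).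
Proof.
move=> M0 MN zN A W Np /andP[t0 t1]; have N0 : (0 < N)%N by lia.
have /andP[k0 k1] := kappa_bound R M0 MN.
have [r0 r1] := ratio_bound R M0 MN.
have M1 : 1 <= M%:R :> R by rewrite ler1n.
have NN : N%:R != 0 :> R by rewrite pnatr_eq0; lia.
have VN := wave_variation_period A W zN.
have V0 : variation z 0%N = 0 by rewrite /variation big_nil.
pose phi k := (1 - t) * g k + t * (g 0%N + 2 * M%:R / N%:R * k%:R).
have gS k : g k <= g k.+1 <= g k + 1.
  have /andP[z1 z2] := periodic_bound k N0 A W zN.
  have /andP[z3 z4] := periodic_bound k.+1 N0 A W zN.
  have d2 : `|z k.+1 - z k| <= 2 by rewrite ler_norml; apply/andP; split; lra.
  have d0 := normr_ge0 (z k.+1 - z k).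
  by rewrite /g variationS; apply/andP; split; lra.
(* Since [N <= p 0], at least one full period, worth 2M in phase, lies between position 0 and the
   anchor of phase 0. *)
have phi0 : phi 0%N <= -2.
  have := variation_mono z Np; rewrite VN /phi mulr0 addr0 /g V0 => H.
  have -> : (1 - t) * ((0 - variation z (p 0%N)) / 2) + t * ((0 - variation z (p 0%N)) / 2)
    = - (variation z (p 0%N) / 2) by field.
  by lra.
have phiN k : phi (k + N)%N = phi k + 2 * M%:R.
  by rewrite /phi /g variation_periodic // VN natrD; field.
have phiS k : phi k <= phi k.+1.
  by rewrite /phi -natr1; have /andP[? ?] := gS k; nra.
have [q [Aq Wq _]] : exists q, [/\ anchors M N q, wave q (squash M N \o phi) &
    forall i, `|phi (q i) - i%:R| <= kappa R M N].
  apply: phase_wave => //; first by lra.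
  (* The origin of kappa. Put r = 2M/N. For t <= 1/(8M) the old anchors still serve: their phases
     have moved by at most 2Mt <= 1/4 <= kappa. For larger t a single step of the phase is at most
     (1 - t) + tr = 1 - t(1 - r) <= 1 - (1 - r)/(8M) = 2 kappa, so no integer is missed by more than
     kappa. *)
  move=> i; case: (leP t (1 / (8 * M%:R))) => tM.
    exists (p i).
    have gi : g (p i) = i%:R by rewrite /g (wave_variation i A W); field.
    have -> : phi (p i) - i%:R =
        t * - (variation z (p i) / 2 - 2 * M%:R / N%:R * (p i)%:R).
      rewrite /phi gi; have -> : g 0%N = i%:R - variation z (p i) / 2.
        by rewrite -gi /g V0; field.
      by ring.
    rewrite normrM normrN (ger0_norm t0).
    have := variation_uniform (p i) N0 zN VN => H.
    have : t * (2 * M%:R) <= 1 / 4.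
      move: tM; rewrite ler_pdivlMr; lra.
    by move=> H'; apply: le_trans (ler_wpM2l t0 H) _; lra.
  apply: (phase_hits _ M0 phiN); first by lra.
  move=> k; rewrite /phi -natr1; have /andP[_ g1] := gS k.
  rewrite /kappa; set r := 2 * M%:R / N%:R in r0 r1 *.
  have H : (1 - t) * g k.+1 <= (1 - t) * (g k + 1) by rewrite ler_wpM2l // subr_ge0.
  have H2 : (1 - r) / (8 * M%:R) <= (1 - r) * t.
    by rewrite ler_wpM2l ?subr_ge0 ?(ltW r1) //; move: tM; rewrite mul1r => /ltW.
  have E : 2 * (1 / 2 - (1 - r) / (16 * M%:R)) = 1 - (1 - r) / (8 * M%:R).
    by field; rewrite gt_eqF //; lra.
  by rewrite E; lra.
by exists q.
Qed.

(** * Continuity *)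

Lemma continuous_ptws (R : realType) (T : topologicalType) (I : eqType)
  (f : T -> {ptws I -> R}) : (forall i, continuous (fun x => f x i)) -> continuous f.
Proof.
move=> H x; apply/cvg_sup => i.
apply: (@continuous_comp_initial _ _ _ (fun g : I -> R => g i) f).
exact: H.
Qed.

Lemma ptws_eval_continuous (R : realType) (I : eqType) (i : I) :
  continuous (fun x : {ptws I -> R} => x i).
Proof. exact: (@proj_continuous I (fun _ => R) i). Qed.

Lemma continuous_bigop (R : realType) (T : topologicalType) (I : Type)
    (op : R -> R -> R) (idx : R) (r : seq I) (P : pred I) (F : I -> T -> R) :
  (forall f g : T -> R, continuous f -> continuous g -> continuous (fun x => op (f x) (g x))) ->
  (forall i, continuous (F i)) -> continuous (fun x => \big[op/idx]_(i <- r | P i) F i x).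
Proof.
move=> cop cF; elim: r => [|i r IHr].
  by under eq_fun do rewrite big_nil; move=> x; exact: cvg_cst.
under eq_fun do rewrite big_cons.
by case: (P i) => //; exact: cop.
Qed.

Lemma continuous_add (R : realType) (T : topologicalType) (f g : T -> R) :
  continuous f -> continuous g -> continuous (fun x => f x + g x).
Proof. by move=> cf cg x; apply: cvgD; [exact: cf|exact: cg]. Qed.

Lemma continuous_sub (R : realType) (T : topologicalType) (f g : T -> R) :
  continuous f -> continuous g -> continuous (fun x => f x - g x).
Proof. by move=> cf cg x; apply: cvgB; [exact: cf|exact: cg]. Qed.

Lemma continuous_mul (R : realType) (T : topologicalType) (f g : T -> R) :
  continuous f -> continuous g -> continuous (fun x => f x * g x).
Proof. by move=> cf cg x; apply: cvgM; [exact: cf|exact: cg]. Qed.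

Lemma continuous_maxr (R : realType) (T : topologicalType) (f g : T -> R) :
  continuous f -> continuous g -> continuous (fun x => Num.max (f x) (g x)).
Proof. by move=> cf cg x; apply: continuous_max; [exact: cf|exact: cg]. Qed.

Lemma continuous_minr (R : realType) (T : topologicalType) (f g : T -> R) :
  continuous f -> continuous g -> continuous (fun x => Num.min (f x) (g x)).
Proof. by move=> cf cg x; apply: continuous_min; [exact: cf|exact: cg]. Qed.

Lemma continuous_const (R : realType) (T : topologicalType) (c : R) :
  continuous (fun _ : T => c).
Proof. by move=> x; exact: cvg_cst. Qed.

Lemma continuous_normr (R : realType) (T : topologicalType) (f : T -> R) :
  continuous f -> continuous (fun x => `|f x|).
Proof. by move=> cf x; apply: cvg_norm; exact: cf. Qed.

Lemma continuous_after (R : realType) (T : topologicalType) (h : R -> R) (f : T -> R) :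
  continuous h -> continuous f -> continuous (fun x => h (f x)).
Proof. by move=> ch cf x; apply: continuous_comp; [exact: cf|exact: ch]. Qed.

Lemma continuous_pair (R : realType) (T : topologicalType) (f g : T -> R) :
  continuous f -> continuous g -> continuous (fun x => (f x, g x)).
Proof. by move=> cf cg x; apply: (cvg_pair (cf x) (cg x)). Qed.

Ltac cont := repeat match goal with
  | |- continuous (fun x => @?f x + - @?g x) => apply: (@continuous_sub _ _ f g)
  | |- continuous (fun x => @?f x + @?g x) => apply: (@continuous_add _ _ f g)
  | |- continuous (fun x => @?f x * @?g x) => apply: (@continuous_mul _ _ f g)
  | |- continuous (fun x => Num.min (@?f x) (@?g x)) => apply: (@continuous_minr _ _ f g)
  | |- continuous (fun x => Num.max (@?f x) (@?g x)) => apply: (@continuous_maxr _ _ f g)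
  | |- continuous (fun x => `|@?f x|) => apply: (@continuous_normr _ _ f)
  | |- continuous (fun x => sin (@?f x)) =>
      apply: (@continuous_after _ _ (@sin _) f); first exact: continuous_sin
  | |- continuous (fun x => cos (@?f x)) =>
      apply: (@continuous_after _ _ (@cos _) f); first exact: continuous_cos
  | |- continuous (fun _ => ?c) => exact: continuous_const
  end.

Lemma continuous_mass (R : realType) (T : topologicalType) n (z : T -> 'I_n.+1 -> R) :
  (forall k, continuous (fun x => z x k)) -> continuous (fun x => mass (z x)).
Proof.
move=> cz; apply: continuous_ptws => s; rewrite /mass /upper /lower.
apply: continuous_maxr; [exact: continuous_const|apply: continuous_sub].
- apply: continuous_bigop => [f g cf cg|k]; first exact: continuous_minr.
  by cont; exact: cz.
- apply: continuous_bigop => [f g cf cg|k]; first exact: continuous_maxr.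
  by cont; exact: cz.
Qed.

Lemma continuous_coords (R : realType) n k :
  continuous (fun x : {ptws cstring n.+1 -> R} => coords x k).
Proof.
rewrite /coords.
apply: continuous_bigop => [f g cf cg|s]; first exact: continuous_add.
by cont; exact: ptws_eval_continuous.
Qed.

Lemma continuous_drift (R : realType) n : continuous (@drift R n).
Proof.
rewrite /drift.
apply: continuous_bigop => [f g cf cg|s]; first exact: continuous_add.
by cont; exact: ptws_eval_continuous.
Qed.

Lemma continuous_variation (R : realType) n k :
  continuous (fun x : {ptws cstring n.+1 -> R} => variation (coords x \o inZp) k).
Proof.
rewrite /variation.
apply: continuous_bigop => [f g cf cg|j]; first exact: continuous_add.
by cont; exact: continuous_coords.
Qed.

(** * Explicit formulas for the maps and their continuity *)

Definition rotate (R : realType) (q : R * R) (y : R) : R :=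
  q.1 * cos (pi * y) - q.2 * sin (pi * y).

Lemma rotateE (R : realType) (a y : R) :
  rotate (cos (pi * a), sin (pi * a)) y = cos (pi * (a + y)).
Proof. by rewrite /rotate mulrDr cosD. Qed.

(** [rotate q y] is the real part of q exp(i pi y), so this is the point of the squashed wave of
    uniform phase that starts at the argument of [q], written without choosing an angle. *)
Definition ofCircle (R : realType) M n (q : R * R) : {ptws cstring n.+1 -> R} :=
  mass (fun k : 'I_n.+1 =>
    clamp (lambda R M n.+1 * rotate q (2 * M%:R / n.+1%:R * k%:R))).

(* For t in [1/2, 1] the values of the wave are stretched by [squash]; for t in
   [0, 1/2] its phase moves linearly to the uniform one. *)
Definition deform (R : realType) M n (tx : R * {ptws cstring n.+1 -> R})
  : {ptws cstring n.+1 -> R} :=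
  let t1 := Num.min 1 (2 - 2 * tx.1) in
  let t2 := Num.max 0 (1 - 2 * tx.1) in
  mass (fun k : 'I_n.+1 =>
    (1 - t1) * coords tx.2 k +
    t1 * clamp (lambda R M n.+1 * rotate (toCircle tx.2)
      ((1 - t2) * (variation (coords tx.2 \o inZp) k / 2) +
       t2 * (2 * M%:R / n.+1%:R * k%:R)))).

Lemma continuous_toCircle (R : realType) n : continuous (@toCircle R n).
Proof.
have c1 : continuous (fun x : {ptws cstring n.+1 -> R} => sin (pi / 2 * coords x ord0)).
  by cont; exact: continuous_coords.
have c2 : continuous (fun x : {ptws cstring n.+1 -> R} => sin (pi / 2 * drift x)).
  by cont; exact: continuous_drift.
exact: (continuous_pair c1 c2).
Qed.

Lemma continuous_ofCircle (R : realType) M n : continuous (@ofCircle R M n).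
Proof.
apply: continuous_mass => k; rewrite /clamp /rotate; cont.
  by move=> q; exact: cvg_fst.
by move=> q; exact: cvg_snd.
Qed.

Lemma continuous_deform (R : realType) M n : continuous (@deform R M n).
Proof.
have c1 : continuous (fun tx : R * {ptws cstring n.+1 -> R} => tx.1).
  by move=> q; exact: cvg_fst.
have c2 : continuous (fun tx : R * {ptws cstring n.+1 -> R} => tx.2).
  by move=> q; exact: cvg_snd.
have cc k : continuous (fun tx : R * {ptws cstring n.+1 -> R} => coords tx.2 k).
  by move=> q; apply: (@continuous_comp _ _ _ snd (fun x => coords x k));
    [exact: c2|exact: continuous_coords].
have cv k : continuous (fun tx : R * {ptws cstring n.+1 -> R} => variation (coords tx.2 \o inZp) k).
  by move=> q; apply: (@continuous_comp _ _ _ snd (fun x => variation (coords x \o inZp) k));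
    [exact: c2|exact: continuous_variation].
have cd : continuous (fun tx : R * {ptws cstring n.+1 -> R} => drift tx.2).
  by move=> q; apply: (@continuous_comp _ _ _ snd (@drift R n));
    [exact: c2|exact: continuous_drift].
apply: continuous_mass => k; rewrite /clamp /rotate /toCircle /=.
by cont.
Qed.

(** * The homotopies *)

(** The range serves two needs: a <= -1 starts the uniform phase below every anchor, and a >= -3
    makes it pass 0 by more than kappa within two periods, since these add 4M >= 4. *)
Lemma circle_angle (R : realType) (q : R * R) : circle q ->
  exists2 a, -3 <= a <= -1 & q = (cos (pi * a), sin (pi * a)).
Proof.
case: q => c s; rewrite /circle /= => cs.
have c1 : -1 <= c <= 1 by apply/andP; split; nra.
have p0 := pi_gt0 R; have pn : pi != 0 :> R by rewrite gt_eqF.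
have b0 := acos_ge0 c1; have b1 := acos_lepi c1.
have bc : cos (acos c) = c by rewrite acosK // in_itv.
have bs : sin (acos c) = `|s|.
  by rewrite sin_acos // -(sqrtr_sqr s); congr Num.sqrt; lra.
set d := acos c / pi; have d0 : 0 <= d by rewrite divr_ge0 // ltW.
have d1 : d <= 1 by rewrite ler_pdivrMr // mul1r.
have dE : pi * d = acos c by rewrite /d mulrC divfK.
case: (leP 0 s) => s0.
  exists (d - 2); first by apply/andP; split; lra.
  rewrite -(cos_period _ 1) -(sin_period _ 1).
  have -> : pi * (d - 2 + 2 * 1%:R) = acos c by rewrite -dE; ring.
  by rewrite bc bs ger0_norm.
exists (- d - 2); first by apply/andP; split; lra.
rewrite -(cos_period _ 1) -(sin_period _ 1).
have -> : pi * (- d - 2 + 2 * 1%:R) = - acos c by rewrite -dE; ring.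
by rewrite cosN sinN bc bs ltr0_norm // opprK.
Qed.

Lemma squash_periodic (R : realType) M N (phi : nat -> R) k :
  (forall k, phi (k + N)%N = phi k + 2 * M%:R) ->
  squash M N (phi (k %% N)%N) = squash M N (phi k).
Proof.
move=> phiN; have E m r : phi (m * N + r)%N = phi r + 2 * (M * m)%N%:R.
  elim: m => [|m IHm]; first by rewrite muln0 mulr0 addr0.
  by rewrite mulSn -addnA addnC phiN IHm mulnS natrD; ring.
by rewrite [in RHS](divn_eq k N) E /squash cos_period.
Qed.

Lemma uniform_phaseD (R : realType) M n (a : R) k :
  a + 2 * M%:R / n.+1%:R * (k + n.+1)%N%:R = a + 2 * M%:R / n.+1%:R * k%:R + 2 * M%:R.
Proof. by rewrite natrD mulrDr addrA divfK // pnatr_eq0. Qed.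

Lemma ofCircle_wave (R : realType) M n (a : R)
    (z := fun k : 'I_n.+1 => squash M n.+1 (a + 2 * M%:R / n.+1%:R * k%:R)) :
  (0 < M)%N -> (2 * M < n.+1)%N -> a <= -1 ->
  @ofCircle R M n (cos (pi * a), sin (pi * a)) = mass z /\
  exists p, [/\ anchors M n.+1 p, wave p (z \o inZp) &
    forall i, `|a + 2 * M%:R / n.+1%:R * (p i)%:R - i%:R| <= kappa R M n.+1].
Proof.
move=> M0 MN a1; split.
  by rewrite /ofCircle; congr mass; apply/funext => k; rewrite rotateE.
have [p [A W near]] := uniform_phase_wave M0 MN a1.
exists p; split=> //.
suff -> : z \o inZp = squash M n.+1 \o (fun k => a + 2 * M%:R / n.+1%:R * k%:R) by [].
by apply/funext => k /=; rewrite -(squash_periodic k (@uniform_phaseD R M n a)).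
Qed.

Lemma ofCircle_BStr (R : realType) M n (q : R * R) : (0 < M)%N -> (2 * M < n.+1)%N ->
  circle q -> BStr M (@ofCircle R M n q).
Proof.
move=> M0 MN /circle_angle[a /andP[_ a1] ->].
by have [-> [p [A W _]]] := ofCircle_wave M0 MN a1; exact: mass_BStr A W.
Qed.

Lemma toCircle_circle (R : realType) M n (x : {ptws cstring n.+1 -> R}) : (0 < M)%N ->
  BStr M x -> circle (toCircle x).
Proof.
move=> M0 xB; have [p [/andP[_ p0] A Ws W]] := BStr_wave M0 xB.
have [-> _] := BStr_phase xB A p0 Ws W.
by rewrite /circle /= cos2Dsin2.
Qed.

(** In terms of the value x of the wave, the cosine of the phase is sin(pi x / 2), so stretching
    acts on values alone; monotonicity and the fixed end points keep the anchors unchanged. *)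
Lemma lambda_sin_comp (R : realType) M N (t : R)
    (m := fun x : R => (1 - t) * x + t * clamp (lambda R M N * sin (pi / 2 * x))) :
  (0 < M)%N -> (2 * M < N)%N -> 0 <= t <= 1 ->
  [/\ forall x y, -1 <= x -> x <= y -> y <= 1 -> m x <= m y, m 1 = 1 & m (-1) = -1].
Proof.
move=> M0 MN /andP[t0 t1]; have [c0 l0] := lambda_gt0 R M0 MN.
have p0 := pi_gt0 R.
have l1 : 1 <= lambda R M N by rewrite /lambda invf_ge1 // cos_le1.
split=> [x y x1 xy y1||]; rewrite /m.
- apply: lerD; first by rewrite ler_wpM2l // subr_ge0.
  apply: ler_wpM2l => //; apply: clamp_le; apply: ler_wpM2l; first exact: ltW.
  have E w : sin (pi / 2 * w) = cos (pi / 2 - pi / 2 * w).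
    by rewrite cosB cos_pihalf sin_pihalf mul0r add0r mul1r.
  have h0 : 0 <= pi / 2 :> R by rewrite divr_ge0 // ltW.
  have h1 : pi / 2 * x <= pi / 2 * y by rewrite ler_wpM2l.
  have h2 : pi / 2 * y <= pi / 2 * 1 by rewrite ler_wpM2l.
  have h3 : pi / 2 * -1 <= pi / 2 * x by rewrite ler_wpM2l.
  have h4 : pi / 2 + pi / 2 = pi :> R by rewrite -splitr.
  rewrite !E; apply: cos_le_cos; [rewrite subr_ge0 -[leRHS]mulr1 //|rewrite lerB //|].
  by rewrite -[leRHS]h4 lerD2l lerNl -[leLHS]mulrN1.
- rewrite mulr1 sin_pihalf mulr1.
  have -> : clamp (lambda R M N) = 1 by have := clampP (lambda R M N); lra.
  by ring.
- rewrite !mulrN1 sinN sin_pihalf mulrN1.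
  have -> : clamp (- lambda R M N) = -1 by have := clampP (- lambda R M N); lra.
  by ring.
Qed.

Lemma deform_BStr (R : realType) M n (t : R) (x : {ptws cstring n.+1 -> R}) :
  (0 < M)%N -> (2 * M < n.+1)%N -> 0 <= t <= 1 -> BStr M x -> BStr M (deform M (t, x)).
Proof.
move=> M0 MN /andP[t0 t1] xB; have [p [/andP[Np p0] A Ws W]] := BStr_wave M0 xB.
have [e gcos] := BStr_phase xB A p0 Ws W.
set z := coords x \o inZp in e gcos W.
pose g k : R := (variation z k - variation z (p 0%N)) / 2.
have zN j : z (j + n.+1)%N = z j by rewrite /z /= inZpDp.
have V0 : variation z 0%N = 0 by rewrite /variation big_nil.
(* [deform] uses only the phase relative to position 0; the phase [g 0] itself enters through
   [toCircle x]. *)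
have gD k : g 0%N + variation z k / 2 = g k by rewrite /g V0; field.
rewrite /deform /=; set t1' := Num.min _ _; set t2 := Num.max _ _.
have [q [Aq Wq]] : exists q, anchors M n.+1 q /\ wave q ((fun k : 'I_n.+1 =>
    (1 - t1') * coords x k + t1' * squash M n.+1
      ((1 - t2) * g k + t2 * (g 0%N + 2 * M%:R / n.+1%:R * k%:R))) \o inZp).
  case: (leP t (1 / 2)) => th.
    have -> : t1' = 1 by rewrite /t1' min_l //; lra.
    have t2' : 0 <= t2 <= 1 by rewrite /t2 max_r; [apply/andP; split|]; lra.
    have [q [Aq Wq]] := interp_phase_wave M0 MN zN A W Np t2'.
    exists q; split=> //; move: Wq; set phi := (fun k : nat => _).
    have phiN k : phi (k + n.+1)%N = phi k + 2 * M%:R.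
      rewrite /phi uniform_phaseD variation_periodic //.
      by rewrite (wave_variation_period A W zN); field.
    suff <- : squash M n.+1 \o phi = (fun k : 'I_n.+1 => (1 - 1) * coords x k +
      1 * squash M n.+1 ((1 - t2) * g k + t2 * (g 0%N + 2 * M%:R / n.+1%:R * k%:R))) \o inZp by [].
    by apply/funext => k /=; rewrite subrr mul0r add0r mul1r -(squash_periodic k phiN).
  have -> : t2 = 0 by rewrite /t2 max_l //; lra.
  have t1b : 0 <= t1' <= 1 by rewrite /t1' min_r; [apply/andP; split|]; lra.
  have [mm m1 mN1] := lambda_sin_comp M0 MN t1b.
  exists p; split=> //; have := wave_comp mm m1 mN1 (proj1 A) W.
  set F := (_ \o z); suff -> : F = (fun k : 'I_n.+1 => (1 - t1') * coords x k +
      t1' * squash M n.+1 ((1 - 0) * g k + 0 * (g 0%N + 2 * M%:R / n.+1%:R * k%:R))) \o inZp by [].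
  apply/funext => k; rewrite /F /= subr0 mul1r mul0r addr0 /squash /g gcos /z /=.
  by rewrite -[inZp (k %% n.+1)%N]/(inZp (inZp k : 'I_n.+1)) valZpK.
suff -> : (fun k : 'I_n.+1 => (1 - t1') * coords x k + t1' * clamp (lambda R M n.+1 *
    rotate (toCircle x) ((1 - t2) * (variation z k / 2) + t2 * (2 * M%:R / n.+1%:R * k%:R)))) =
    (fun k : 'I_n.+1 => (1 - t1') * coords x k + t1' * squash M n.+1
      ((1 - t2) * g k + t2 * (g 0%N + 2 * M%:R / n.+1%:R * k%:R))).
  exact: mass_BStr Aq Wq.
apply/funext => k; rewrite e rotateE /squash -/(g 0%N) -(gD k).
by congr (_ + _ * clamp (_ * cos (_ * _))); ring.
Qed.

Lemma deform_homotopic (R : realType) M n : (0 < M)%N -> (2 * M < n.+1)%N ->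
  @homotopic_on R _ _ (@BStr R n.+1 M) (@BStr R n.+1 M) (@ofCircle R M n \o @toCircle R n) idfun.
Proof.
move=> M0 MN; exists (@deform R M n); split.
- by apply: continuous_in_subspaceT => p _; exact: continuous_deform.
- move=> x xB; split.
    rewrite /deform /ofCircle /=; congr mass; apply/funext => k.
    rewrite min_l ?max_r; [|lra|lra].
    rewrite subrr mul0r add0r mul1r; congr (clamp (_ * rotate _ _)).
    by rewrite mulr0 !subr0 subrr mul0r add0r mul1r.
  rewrite /deform /= min_r ?max_l; [|lra|lra].
  rewrite -[RHS](mass_coords xB); congr mass; apply/funext => k.
  by ring.
- by move=> t x t01 xB; exact: deform_BStr.
Qed.

(** A nonnegative inner product of the unit vectors f q and q bounds the squared norm on the segment
    joining them below by (1 - t)^2 + t^2 > 0, so the segment can be projected radially to the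
    circle. *)
Lemma circle_homotopic_id (R : realType) (f : R * R -> R * R) : continuous f ->
  (forall q, circle q -> circle (f q)) ->
  (forall q, circle q -> 0 <= (f q).1 * q.1 + (f q).2 * q.2) ->
  @homotopic_on R _ _ (@circle R) (@circle R) f idfun.
Proof.
move=> cf fC fdot.
pose v1 (tq : R * (R * R)) := (1 - tq.1) * (f tq.2).1 + tq.1 * tq.2.1.
pose v2 (tq : R * (R * R)) := (1 - tq.1) * (f tq.2).2 + tq.1 * tq.2.2.
pose l tq := Num.sqrt (v1 tq * v1 tq + v2 tq * v2 tq).
have lpos tq : 0 <= tq.1 <= 1 -> circle tq.2 -> 0 < v1 tq * v1 tq + v2 tq * v2 tq.
  case: tq => t q /= /andP[t0 t1] qC; have := fdot q qC; have := fC q qC; move: qC.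
  rewrite /circle /v1 /v2 /=; case: (f q) => a b; case: q => c d /= q1 f1 dot.
  have -> : ((1 - t) * a + t * c) * ((1 - t) * a + t * c) +
     ((1 - t) * b + t * d) * ((1 - t) * b + t * d) =
     (1 - t) ^+ 2 * (a ^+ 2 + b ^+ 2) + t ^+ 2 * (c ^+ 2 + d ^+ 2) +
     2 * t * (1 - t) * (a * c + b * d) by ring.
  rewrite q1 f1.
  have : 0 <= 2 * t * (1 - t) * (a * c + b * d).
    by rewrite !mulr_ge0 // subr_ge0.
  by nra.
have ct : continuous (fun tq : R * (R * R) => tq.1) by move=> ?; exact: cvg_fst.
have cq : continuous (fun tq : R * (R * R) => tq.2) by move=> ?; exact: cvg_snd.
have c1 : continuous (fun q : R * R => q.1) by move=> ?; exact: cvg_fst.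
have c2 : continuous (fun q : R * R => q.2) by move=> ?; exact: cvg_snd.
have cq1 : continuous (fun tq : R * (R * R) => tq.2.1).
  by move=> tq; apply: (@continuous_comp _ _ _ snd fst); [exact: cq|exact: c1].
have cq2 : continuous (fun tq : R * (R * R) => tq.2.2).
  by move=> tq; apply: (@continuous_comp _ _ _ snd snd); [exact: cq|exact: c2].
have cfq : continuous (fun tq : R * (R * R) => f tq.2).
  by move=> tq; apply: (@continuous_comp _ _ _ snd f); [exact: cq|exact: cf].
have cf1 : continuous (fun tq : R * (R * R) => (f tq.2).1).
  by move=> tq; apply: (@continuous_comp _ _ _ (fun tq => f tq.2) fst); [exact: cfq|exact: c1].
have cf2 : continuous (fun tq : R * (R * R) => (f tq.2).2).
  by move=> tq; apply: (@continuous_comp _ _ _ (fun tq => f tq.2) snd); [exact: cfq|exact: c2].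
have cv1 : continuous v1 by rewrite /v1; cont.
have cv2 : continuous v2 by rewrite /v2; cont.
have cl : continuous l.
  by apply: (@continuous_after _ _ (@Num.sqrt R)); [exact: sqrt_continuous|cont].
exists (fun tq => (v1 tq / l tq, v2 tq / l tq)); split.
- apply: continuous_in_subspaceT => tq /set_mem [t01 qC].
  have l0 : l tq != 0 by rewrite gt_eqF // sqrtr_gt0 lpos.
  have cV : (fun y => (l y)^-1) @ tq --> (l tq)^-1 by apply: cvgV => //; exact: cl.
  apply: (@cvg_pair _ _ _ (nbhs tq) (nbhs (v1 tq / l tq)) (nbhs (v2 tq / l tq))).
    by apply: cvgM => //; exact: cv1.
  by apply: cvgM => //; exact: cv2.
- move=> q qC; have := fC q qC; move: (qC); rewrite /circle /l /v1 /v2 /= !expr2.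
  rewrite !subrr !subr0 !mul0r !mul1r !addr0 !add0r => -> ->.
  rewrite sqrtr1 !divr1; split; first by case: (f q).
  by case: q qC.
- move=> t q t01 qC; have l0 := lpos (t, q) t01 qC.
  rewrite /circle /= !expr_div_n /l sqr_sqrtr ?(ltW l0) // -mulrDl !expr2 divff //.
  by rewrite gt_eqF.
Qed.

Lemma sin_halfpi_sign (R : realType) (w v : R) : `|w| <= 1 -> 0 <= w * v ->
  0 <= sin (pi / 2 * w) * v.
Proof.
have p0 := pi_gt0 R.
have pos (u : R) : 0 <= u <= 1 -> 0 <= sin (pi / 2 * u).
  by move=> /andP[u0 u1]; apply: sin_ge0_pi; apply/andP; split; nra.
rewrite ler_norml => /andP[w1 w2] wv; case: (ltgtP w 0) => w0.
- have -> : w = - - w by rewrite opprK.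
  rewrite mulrN sinN mulNr -mulrN; apply: mulr_ge0; first by apply: pos; apply/andP; split; lra.
  by rewrite oppr_ge0 -(nmulr_rge0 _ w0).
- apply: mulr_ge0; first by apply: pos; rewrite ltW.
  by rewrite -(pmulr_rge0 _ w0).
- by rewrite w0 mulr0 sin0 mul0r.
Qed.

Lemma coords_le1 (R : realType) M n (x : {ptws cstring n.+1 -> R}) k : BStr M x ->
  `|coords x k| <= 1.
Proof.
move=> xB; rewrite -(coords_norm k xB); have [x0 _ x1 _] := xB.
rewrite -[leRHS]x1; apply: ler_sum => s _.
by rewrite ler_piMr // sg_norm_le1.
Qed.

Lemma toCircle_ofCircle_dot (R : realType) M n (q : R * R) (x := @ofCircle R M n q) :
  (0 < M)%N -> (2 * M < n.+1)%N -> circle q ->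
  0 <= (toCircle x).1 * q.1 + (toCircle x).2 * q.2.
Proof.
move=> M0 MN qC; have xB : BStr M x by exact: ofCircle_BStr.
have [a /andP[a3 a1] qE] := circle_angle qC.
have [E [p [A W near]]] := ofCircle_wave M0 MN a1.
rewrite -qE -/x in E; set z := (fun k : 'I_n.+1 => _) in E W.
have /andP[k0 k1] := kappa_bound R M0 MN.
have [c0 l0] := lambda_gt0 R M0 MN.
have [r0 r1] := ratio_bound R M0 MN.
have M1 : 1 <= M%:R :> R by rewrite ler1n.
have z0 : z ord0 = clamp (lambda R M n.+1 * q.1) by rewrite /z /= mulr0 addr0 qE.
have Ws s : x s != 0 -> wave p (sgs R s).
  by rewrite E => /mass_cut[u u01 ->]; exact: cut_wave (proj1 A) W u01.
have [x0 _ x1 _] := xB.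
have [i H] : exists i, (p i <= 2 * n.+1 < p i.+1)%N.
  apply: (anchors_locate A); rewrite leqNgt; apply/negP => lt.
  have := near 0%N; rewrite subr0 ler_norml => /andP[_].
  have : 2 * M%:R / n.+1%:R * (2 * n.+1)%N%:R <= 2 * M%:R / n.+1%:R * (p 0%N)%:R :> R.
    by rewrite ler_wpM2l ?(ltW r0) // ler_nat ltnW.
  rewrite natrM [2 * n.+1%:R]mulrC mulrA divfK ?pnatr_eq0 //.
  by move: (_ * (p 0%N)%:R) => w h1 h2; lra.
apply: addr_ge0; apply: sin_halfpi_sign.
- exact: coords_le1 xB.
- rewrite /coords mulr_suml; apply: sumr_ge0 => s _.
  have [->|] := eqVneq (x s) 0; first by rewrite !mul0r.
  rewrite -mulrA {1}E => /mass_cut[u /andP[u0 _] sE]; apply: mulr_ge0 => //.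
  rewrite sE ffunE /threshold z0.
  have C := clampP (lambda R M n.+1 * q.1); case: (leP u _) => H1.
    by rewrite /= mul1r -(pmulr_rge0 _ l0); lra.
  case: (leP _ (- u)) => H2; last by rewrite /= mul0r.
  by rewrite /= mulN1r oppr_ge0 -(pmulr_rle0 _ l0); lra.
- rewrite (drift_wave xB A Ws H) normrM; have := coords_le1 ord0 xB.
  have := normr_ge0 (coords x ord0).
  case: (sign_cases R i) => ->; rewrite ?normrN normr1 mul1r => ? ?.
    by rewrite ger0_norm; lra.
  by rewrite ger0_norm; lra.
- rewrite (drift_wave xB A Ws H).
  pose y : R := a + 2 * (2 * M)%N%:R.
  have yE : y = a + 2 * M%:R / n.+1%:R * (2 * n.+1)%N%:R.
    have -> : (2 * n.+1)%N%:R = n.+1%:R * 2 :> R by rewrite natrM mulrC.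
    by rewrite [_ / _ * _]mulrA divfK ?pnatr_eq0 // /y natrM; ring.
  (* Anchors match integers only up to kappa, so the phase [y] of position [2 * n.+1] may fall
     outside [i, i+1]. It is then within kappa of an integer, all strings of nonzero weight have the
     same bit at position 0, and the drift vanishes. *)
  have unit (j : nat) : `|y - j%:R| <= kappa R M n.+1 -> `|coords x ord0| = 1.
    move=> /(squash_near M0 MN) sy.
    have z1 : z ord0 = (-1) ^+ j by rewrite -sy /z /squash mulr0 addr0 /y cos_period.
    rewrite -(coords_norm ord0 xB) -[RHS]x1; apply: eq_bigr => s _.
    have [->|] := eqVneq (x s) 0; first by rewrite mul0r.
    rewrite {1}E => /mass_cut[u /andP[u0 u1] ->]; rewrite ffunE /threshold z1.
    case: (sign_cases R j) => ->; first by rewrite u1 /= normr1 mulr1.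
    by rewrite ifF ?lerN2 ?u1 /= ?normrN ?normr1 ?mulr1 //; apply/negbTE; rewrite -ltNge; lra.
  pose phi (k : nat) : R := a + 2 * M%:R / n.+1%:R * k%:R.
  have mono k k' : (k <= k')%N -> phi k <= phi k'.
    by move=> kk; rewrite lerD2l ler_wpM2l ?(ltW r0) // ler_nat.
  have /andP[/mono pi1 /ltnW/mono pi2] := H; rewrite [phi (2 * _)%N]/phi -yE in pi1 pi2.
  have := near i; have := near i.+1; rewrite -!/(phi _) !ler_norml => /andP[_ n1] /andP[n2 _].
  case: (leP y i%:R) => yi.
    rewrite (unit i) ?subrr ?mulr0 ?mul0r // ler_norml; apply/andP; split; lra.
  case: (leP i.+1%:R y) => yi1.
    rewrite (unit i.+1) ?subrr ?mulr0 ?mul0r // ler_norml; apply/andP; split; lra.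
  have -> : q.2 = (-1) ^+ i * sin (pi * (y - i%:R)).
    rewrite qE /= -(sin_period _ (2 * M)) -/y -(alternatingn (@sinDpi R)); congr sin.
    by rewrite -[pi *+ i]mulr_natr; ring.
  have s0 : 0 <= sin (pi * (y - i%:R)).
    have p0 := pi_gt0 R; rewrite -natr1 in yi1.
    by apply: sin_ge0_pi; apply/andP; split; nra.
  have d0 : 0 <= 1 - `|coords x ord0| by rewrite subr_ge0; exact: coords_le1 xB.
  have -> : (-1) ^+ i * (1 - `|coords x ord0|) * ((-1) ^+ i * sin (pi * (y - i%:R))) =
      (1 - `|coords x ord0|) * sin (pi * (y - i%:R)).
    by case: (sign_cases R i) => ->; ring.
  exact: mulr_ge0.
Qed.

Close Scope ring_scope.
Close Scope classical_set_scope.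

Theorem theorem6p2 (R : realType) (N M : nat) :
  (0 < M)%N -> (2 * M < N)%N ->
  @homotopy_equivalent R _ _ (@BStr R N M) (@circle R).
Proof.
case: N => [|n] M0 MN; first by rewrite ltn0 in MN.
exists (@toCircle R n), (@ofCircle R M n); split.
- by apply: continuous_in_subspaceT => x _; exact: continuous_toCircle.
- by move=> x; exact: toCircle_circle.
- by apply: continuous_in_subspaceT => q _; exact: continuous_ofCircle.
- by move=> q; exact: ofCircle_BStr.
- split; first exact: deform_homotopic.
  apply: circle_homotopic_id.
  + move=> q; apply: (@continuous_comp _ _ _ (@ofCircle R M n) (@toCircle R n)).
      exact: continuous_ofCircle.
    exact: continuous_toCircle.
  + by move=> q qC; apply: (toCircle_circle M0); exact: ofCircle_BStr.
  + by move=> q; exact: toCircle_ofCircle_dot.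
Qed.
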